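(* Let $X$ be a strongly minimal differential equation of order $n$ defined over a finitely generated differential field $K$. Then any nonalgebraic solution $f$ of $X$ is not $d$-reducible for any $d<n$. It also follows that $f$ is not Pfaffian, Liouvillian, or elementary.
   Context: Everything lies in a saturated model $(\mathcal{U},\delta)$ of $DCF_0$ (differentially closed fields of characteristic zero with one derivation) with field of constants $\mathbb{C}$. $K\langle y\rangle$ is the differential field generated by $y$ over $K$, and $^{alg}$ denotes algebraic closure. ''Nonalgebraic'' means not algebraic over $K$, and ''$d$-reducible'', ''Liouvillian'' and ''elementary'' are meant over $K$. A differential equation $X$ over $K$ is identified with its solution set. Its order is $\sup\{\operatorname{trdeg}_K K\langle y\rangle : y\in X\}$. It is strongly minimal if it is infinite and every definable (with parameters) subset of $X$ is finite or has finite complement in $X$. An element $a$ is $r$-reducible over $K$ if there is a finite chain of finitely generated differential field extensions $K=R_0\subset R_1\subset\cdots\subset R_m$ of $K$ with $a\in R_m$ and $\operatorname{trdeg}(R_i/R_{i-1})\leq r$ for all $i$. A finitely generated differential field extension $L$ of $K$ is elementary (resp. Liouvillian) if there is a tower of differential fields $K=F_0\subset F_1\subset\cdots\subset F_m=L$ with $F_i=F_{i-1}(\alpha)$, where for each $i$, in the elementary case: $\delta\alpha=\delta h/h$ for some $h\in F_{i-1}$, or $\delta\alpha/\alpha=\delta h$ for some $h\in F_{i-1}$, or $\alpha\in F_{i-1}^{alg}$; in the Liouvillian case: $\delta\alpha\in F_{i-1}$, or $\delta\alpha/\alpha\in F_{i-1}$, or $\alpha\in F_{i-1}^{alg}$.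 An element is elementary (Liouvillian) if it lies in an elementary (Liouvillian) extension of $K$. Complex analytic functions $f_1,\ldots,f_l$ on a domain $U\subseteq\mathbb{C}^m$ with coordinates $\bar x=(x_1,\ldots,x_m)$ form a $\mathbb{C}$-Pfaffian chain if there are polynomials $p_{ij}(u_1,\ldots,u_m,v_1,\ldots,v_i)$ with coefficients in $\mathbb{C}$ such that $\frac{\partial f_i}{\partial x_j}=p_{ij}(\bar x,f_1(\bar x),\ldots,f_i(\bar x))$ for $1\leq i\leq l$ and $1\leq j\leq m$. A function is ($\mathbb{C}$-)Pfaffian if it can be written as a polynomial with coefficients in $\mathbb{C}$ in the functions of some $\mathbb{C}$-Pfaffian chain.
   Formalization: The claim that f is not Pfaffian, Liouvillian, or elementary is stated only for order n > 1; for n = 1 it is false: over K = Q the equation δy = 1 is strongly minimal of order 1 and its nonalgebraic solutions are Liouvillian and Pfaffian. *)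

(* Defs.v *)
From HB Require Import structures.
From mathcomp Require Import all_boot all_order all_algebra.
From mathcomp Require Import complex.
(* The notations of mpoly clash with those of MathComp-Analysis. *)
From mathcomp Require Import -(notations) mpoly.
From mathcomp Require Import all_classical all_reals all_analysis.

Set Implicit Arguments.
Unset Strict Implicit.
Unset Printing Implicit Defensive.

Import Order.TTheory GRing.Theory Num.Theory.
Import numFieldNormedType.Exports.

Local Open Scope classical_set_scope.
Local Open Scope ring_scope.

(* The alias gives R[i] the topology and norm that every numFieldType has. *)
Definition Cplx (R : realType) : numFieldType := R[i].

Section FirstOrder.
Variables (U : fieldType) (delta : U -> U).

Inductive dterm :=
| DVar of nat
| DConst of U
| DAdd of dterm & dterm
| DOpp of dterm
| DMul of dterm & dterm
| DDer of dterm.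

Inductive dform :=
| DEq of dterm & dterm
| DNot of dform
| DAnd of dform & dform
| DEx of nat & dform.

Fixpoint dterm_params (t : dterm) : set U :=
  match t with
  | DVar _ => set0
  | DConst c => [set c]
  | DAdd t1 t2 | DMul t1 t2 => dterm_params t1 `|` dterm_params t2
  | DOpp t1 | DDer t1 => dterm_params t1
  end.

Fixpoint dform_params (phi : dform) : set U :=
  match phi with
  | DEq t1 t2 => dterm_params t1 `|` dterm_params t2
  | DNot phi1 | DEx _ phi1 => dform_params phi1
  | DAnd phi1 phi2 => dform_params phi1 `|` dform_params phi2
  end.

Fixpoint dterm_eval (e : nat -> U) (t : dterm) : U :=
  match t with
  | DVar i => e i
  | DConst c => c
  | DAdd t1 t2 => dterm_eval e t1 + dterm_eval e t2
  | DOpp t1 => - dterm_eval e t1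
  | DMul t1 t2 => dterm_eval e t1 * dterm_eval e t2
  | DDer t1 => delta (dterm_eval e t1)
  end.

Fixpoint dform_sat (e : nat -> U) (phi : dform) : Prop :=
  match phi with
  | DEq t1 t2 => dterm_eval e t1 = dterm_eval e t2
  | DNot phi1 => ~ dform_sat e phi1
  | DAnd phi1 phi2 => dform_sat e phi1 /\ dform_sat e phi2
  | DEx i phi1 =>
      exists x : U, dform_sat (fun k => if k == i then x else e k) phi1
  end.

(* Variable 0 is the argument; any other free variable is read as the
   parameter 0, so every formula counts as a formula in one free variable. *)
Definition dform_sat1 (phi : dform) (y : U) : Prop :=
  dform_sat (fun k => if k == 0%N then y else 0) phi.

Definition definable (S : set U) : Prop :=
  exists phi : dform, S = [set y | dform_sat1 phi y].

(* |U|-saturation: 1-types over fewer than |U| parameters are realized. *)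
Definition saturated : Prop :=
  forall (A : set U) (Phi : set dform),
    ~ ([set: U] #<= A)%card ->
    (forall phi, Phi phi -> dform_params phi `<=` A) ->
    (forall F : set dform, finite_set F -> F `<=` Phi ->
       exists y : U, forall phi, F phi -> dform_sat1 phi y) ->
    exists y : U, forall phi, Phi phi -> dform_sat1 phi y.

End FirstOrder.

Section DifferentialAlgebra.
Variables (U : fieldType) (delta : U -> U).

Definition derivation : Prop :=
  (forall x y, delta (x + y) = delta x + delta y) /\
  (forall x y, delta (x * y) = delta x * y + x * delta y).

(* P : mpoly N U stands for the differential polynomial
   P(y, delta y, ..., delta^(N-1) y). *)
Definition deval (N : nat) (P : mpoly N U) (y : U) : U :=
  meval (fun i : 'I_N => iter i delta y) P.

(* Blum's axioms.  In characteristic 0 the condition on mderiv says that P has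
   order exactly N; Q is a nonzero differential polynomial of order < N.  The
   case N = 0, where Q is a nonzero constant, is algebraic closedness. *)
Definition DCF0 : Prop :=
  [/\ [pchar U] =i pred0,
      derivation
    & forall (N : nat) (P : mpoly N.+1 U) (Q : mpoly N U),
        mderiv ord_max P != 0 -> Q != 0 ->
        exists y : U, deval P y = 0 /\ deval Q y != 0].

Definition subfield (F : set U) : Prop :=
  [/\ F 1,
      forall x y, F x -> F y -> F (x - y)
    & forall x y, F x -> F y -> F (x / y)].

Definition dsubfield (F : set U) : Prop :=
  subfield F /\ (forall x, F x -> F (delta x)).

(* The field K(S), resp. the differential field K<S>, is fgen (K `|` S),
   resp. dgen (K `|` S). *)
Definition fgen (S : set U) : set U := smallest subfield S.
Definition dgen (S : set U) : set U := smallest dsubfield S.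

Definition fin_gen_dfield (K : set U) : Prop :=
  exists2 S : set U, finite_set S & K = dgen S.

Definition fin_gen_dext (K L : set U) : Prop :=
  exists2 S : set U, finite_set S & L = dgen (K `|` S).

Definition algebraic_over (K : set U) (a : U) : Prop :=
  exists p : {poly U}, [/\ p != 0, forall i, K p`_i & root p a].

Definition mpoly_over (K : set U) (N : nat) (P : mpoly N U) : Prop :=
  forall mon : multinom N, K (mcoeff mon P).

Definition alg_indep (K : set U) (d : nat) (a : 'I_d -> U) : Prop :=
  forall P : mpoly d U, mpoly_over K P -> meval a P = 0 -> P = 0.

Definition trdeg_le (K L : set U) (r : nat) : Prop :=
  forall (d : nat) (a : 'I_d -> U),
    (forall i, L (a i)) -> alg_indep K a -> (d <= r)%N.

(* A differential equation in one unknown over K: a finite system of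
   differential polynomial equations P = 0 and inequations Q <> 0.  The
   inequations allow rational equations, whose denominators must not vanish. *)
Definition diff_equation (K X : set U) : Prop :=
  exists (N : nat) (eqs neqs : seq (mpoly N.+1 U)),
    [/\ forall P, P \in eqs ++ neqs -> mpoly_over K P
      & X = [set y | (forall P, P \in eqs -> deval P y = 0) /\
                     (forall Q, Q \in neqs -> deval Q y != 0)]].

(* n is the supremum of trdeg_K K<y> for y in X. *)
Definition has_order (K X : set U) (n : nat) : Prop :=
  (forall y, X y -> trdeg_le K (dgen (K `|` [set y])) n) /\
  (forall k : nat,
     (forall y, X y -> trdeg_le K (dgen (K `|` [set y])) k) -> (n <= k)%N).

Definition strongly_minimal (X : set U) : Prop :=
  infinite_set X /\
  forall S : set U, definable delta S -> S `<=` X ->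
    finite_set S \/ finite_set (X `\` S).

Definition reducible (r : nat) (K : set U) (a : U) : Prop :=
  exists (m : nat) (F : nat -> set U),
    [/\ F 0%N = K,
        F m a,
        forall i, (i <= m)%N -> fin_gen_dext K (F i)
      & forall i, (i < m)%N ->
          F i `<=` F i.+1 /\ trdeg_le (F i) (F i.+1) r].

Definition tower_ext (step : set U -> U -> Prop) (K L : set U) : Prop :=
  fin_gen_dext K L /\
  exists (m : nat) (F : nat -> set U) (alpha : nat -> U),
    [/\ F 0%N = K,
        F m = L,
        forall i, (i <= m)%N -> dsubfield (F i)
      & forall i, (i < m)%N ->
          F i.+1 = fgen (F i `|` [set alpha i]) /\ step (F i) (alpha i)].

Definition elementary_step (F : set U) (a : U) : Prop :=
  [\/ exists h, [/\ F h, h != 0 & delta a = delta h / h],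
      a != 0 /\ (exists2 h, F h & delta a / a = delta h)
    | algebraic_over F a].

Definition liouvillian_step (F : set U) (a : U) : Prop :=
  [\/ F (delta a),
      a != 0 /\ F (delta a / a)
    | algebraic_over F a].

Definition elementary (K : set U) (a : U) : Prop :=
  exists2 L, tower_ext elementary_step K L & L a.

Definition liouvillian (K : set U) (a : U) : Prop :=
  exists2 L, tower_ext liouvillian_step K L & L a.

End DifferentialAlgebra.

Section AnalyticFunctions.
Variables (R : realType) (m : nat).
Notation C := (Cplx R).
Implicit Types (D : set 'rV[C]_m) (g : 'rV[C]_m -> C).

(* Near a, g is the sum of a power series in the x_i - a_i that converges
   absolutely on the closed polydisc of radius r.  The order on C makes
   0 < r mean that r is real and positive. *)
Definition analytic_at g (a : 'rV[C]_m) : Prop :=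
  exists (r M : C) (c : multinom m -> C),
    [/\ 0 < r,
        forall N : nat,
          \sum_(k : bmultinom m N) `|c k| * r ^+ mdeg k <= M
      & forall x : 'rV[C]_m, (forall i, `|x 0 i - a 0 i| < r) ->
          (fun N : nat => \sum_(k : bmultinom m N)
             c k * \prod_(i < m) (x 0 i - a 0 i) ^+ k i) @ \oo --> g x].

Definition analytic_on D g : Prop := forall a, D a -> analytic_at g a.

Definition domain D : Prop := [/\ D !=set0, open D & connected D].

(* g' is the partial derivative of g with respect to x_j on D. *)
Definition partial_on D (j : 'I_m) g (g' : 'rV[C]_m -> C) : Prop :=
  forall x, D x -> is_derive x (delta_mx 0 j : 'rV[C]_m) g (g' x).

Definition pfaffian_args (l : nat) (f : 'I_l -> 'rV[C]_m -> C) (i : 'I_l)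
    (x : 'rV[C]_m) : 'I_(m + i.+1) -> C :=
  fun k => match fintype.split k with
           | inl a => x 0 a
           | inr b => f (widen_ord (ltn_ord i) b) x
           end.
Arguments pfaffian_args {l} f i x.

Definition pfaffian_chain D (l : nat) (f : 'I_l -> 'rV[C]_m -> C) : Prop :=
  (forall i, analytic_on D (f i)) /\
  exists p : forall i : 'I_l, 'I_m -> mpoly (m + i.+1) C,
    forall i j,
      partial_on D j (f i) (fun x => meval (pfaffian_args f i x) (p i j)).

Definition pfaffian_on D g : Prop :=
  exists (l : nat) (f : 'I_l -> 'rV[C]_m -> C) (q : mpoly l C),
    pfaffian_chain D f /\ (forall x, D x -> g x = meval (fun i => f i x) q).

End AnalyticFunctions.

Section PfaffianElements.
Variables (R : realType) (U : fieldType) (delta : U -> U).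
Variable iota : Cplx R -> U.

(* sigma identifies A, a differential subring of U containing the constants
   iota(C), with a ring of analytic functions on D; the constants become
   constant functions and delta becomes d/dx_j. *)
Record realization (m : nat) (D : set 'rV[Cplx R]_m) (j : 'I_m) (A : set U)
    (sigma : U -> 'rV[Cplx R]_m -> Cplx R) : Prop := Realization {
  rlz_const : forall c, A (iota c);
  rlz_add : forall a b, A a -> A b -> A (a + b);
  rlz_mul : forall a b, A a -> A b -> A (a * b);
  rlz_der : forall a, A a -> A (delta a);
  rlz_analytic : forall a, A a -> analytic_on D (sigma a);
  rlz_sigma_const : forall c x, D x -> sigma (iota c) x = c;
  rlz_sigma_add : forall a b x, A a -> A b -> D x ->
    sigma (a + b) x = sigma a x + sigma b x;
  rlz_sigma_mul : forall a b x, A a -> A b -> D x ->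
    sigma (a * b) x = sigma a x * sigma b x;
  rlz_sigma_der : forall a, A a -> partial_on D j (sigma a) (sigma (delta a));
  rlz_sigma_inj : forall a, A a -> (forall x, D x -> sigma a x = 0) -> a = 0
}.

(* An element f of U is a function only through a realization of K<f> as a
   differential field of meromorphic functions.  On a smaller domain the
   generators of K and f have no poles, so this is expressed by analytic
   functions on the differential ring A, of which K<f> lies in the fraction
   field. *)
Definition pfaffian (K : set U) (f : U) : Prop :=
  exists (m : nat) (D : set 'rV[Cplx R]_m) (j : 'I_m) (A : set U)
         (sigma : U -> 'rV[Cplx R]_m -> Cplx R),
    [/\ domain D,
        realization D j A sigma,
        forall a, K a -> exists b c, [/\ A b, A c, c != 0 & a = b / c],
        A f
      & pfaffian_on D (sigma f)].

End PfaffianElements.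

(* Main.v *)
Require Import Defs.
From HB Require Import structures.
From mathcomp Require Import all_boot all_order all_algebra.
From mathcomp Require Import complex.
From mathcomp Require Import -(notations) mpoly.
From mathcomp Require Import all_classical all_reals all_analysis.
From mathcomp Require Import perm ring.

(** The idea. Let [f] be a solution of [X] and [F] a differential field
    containing [K]. Strong minimality forces a dichotomy
    ([algebraic_or_generic]): either [f] is algebraic over [F], or [f], ...,
    [delta^(n-1) f] are algebraically independent over [F]. For a relation [P]
    of order below [n] over [F] defines a subset of [X] that is finite or
    cofinite. It cannot be cofinite, since some solution of full rank [n] over
    [K] specializes to infinitely many solutions with [P <> 0]; and if [f]
    satisfies [P] without being algebraic over [F], then [f] itself specializes
    to infinitely many solutions with [P = 0].

    Now let [f], not algebraic over [K], lie at the top of a tower of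
    differential fields. At the first stage [F'] over which [f] is algebraic,
    with [F] the stage before, the [n] elements [f], ..., [delta^(n-1) f] are
    independent over [F] and algebraic over [F'], so that step has
    transcendence degree at least [n] ([tower_degree]). This excludes towers
    with steps of degree [d < n]. Liouvillian and elementary towers have steps
    of degree at most one, so they are excluded when [n > 1].

    The specializations come from [dense_specializations]. If the first [k]
    derivatives of [f] are independent over [F] and the first [k + 1] are not,
    let [G] be a minimal equation of [delta^k f] over the lower derivatives.
    Modulo [G], every differential polynomial in a zero [z] of [G] is a fraction
    in [z], ..., [delta^k z] with a denominator of order below [k]: the
    separant of [G] is invertible, so the derivative of [G z = 0] yields
    [delta^(k+1) z] ([regular_next]). Hence every zero of [G] off a suitable
    hypersurface of order below [k] satisfies the same conditions as [f], and
    Blum's axioms provide such zeros off any further hypersurface.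

    A Pfaffian [f] is a polynomial in functions [y_1], ..., [y_r] (the
    coordinates and a chain) on a domain, with complex coefficients, and the
    derivative of each [y_i] is a polynomial in [y_1], ..., [y_i]. It remains to
    find elements of [U] with the same derivatives and the same polynomial
    expression for [f]; over [K] and the finitely many coefficients they
    generate a tower with steps of degree at most one. To this end the ring
    generated by the functions is divided by a maximal differential ideal that
    avoids the nonzero elements of the realized ring; such an ideal is prime
    ([prime_diff_ideal]). The countable differential ring generated by [f] and
    the coefficients embeds into this quotient as well as into [U], and the
    images of [y_1], ..., [y_r] in [U] are found one after another
    ([extend_place]): a root of the minimal equation of [y_i] if it is
    algebraic, and otherwise, by saturation, a solution of its first-order
    equation that is transcendental over the countable ring built so far. *)

Set Implicit Arguments.
Unset Strict Implicit.
Unset Printing Implicit Defensive.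

Import Order.TTheory GRing.Theory Num.Theory.
Import numFieldNormedType.Exports.

Local Open Scope classical_set_scope.
Local Open Scope ring_scope.

(** * Subfields and algebraic closure *)

Definition mem_of (U : fieldType) (F : set U) (hF : subfield F) : {pred U} :=
  fun x => `[< F x >].

Lemma mem_ofP (U : fieldType) (F : set U) (hF : subfield F) x :
  reflect (F x) (x \in mem_of hF).
Proof. exact: asboolP. Qed.

Lemma mem_of_divring (U : fieldType) (F : set U) (hF : subfield F) :
  divring_closed (mem_of hF).
Proof.
have [F1 FB FD] := hF.
by split=> [|x y /mem_ofP Fx /mem_ofP Fy|x y /mem_ofP Fx /mem_ofP Fy];
  apply/mem_ofP; auto.
Qed.

HB.instance Definition _ (U : fieldType) (F : set U) (hF : subfield F) :=
  GRing.isDivringClosed.Build U (mem_of hF) (mem_of_divring hF).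

(** The subfield as a field in its own right, so that the theory of elements
    algebraic over a field applies to it. *)
Record elt (U : fieldType) (F : set U) (hF : subfield F) := Elt {
  elt_val :> U; _ : elt_val \in mem_of hF }.

HB.instance Definition _ (U : fieldType) (F : set U) (hF : subfield F) :=
  [isSub for @elt_val U F hF].
HB.instance Definition _ (U : fieldType) (F : set U) (hF : subfield F) :=
  [Choice of elt hF by <:].
HB.instance Definition _ (U : fieldType) (F : set U) (hF : subfield F) :=
  [SubChoice_isSubIntegralDomain of elt hF by <:].
HB.instance Definition _ (U : fieldType) (F : set U) (hF : subfield F) :=
  [SubIntegralDomain_isSubField of elt hF by <:].

Section AlgebraicClosure.
Variable U : fieldType.
Implicit Types E F : set U.

Lemma subfield0 F : subfield F -> F 0.
Proof. by move=> hF; apply/(mem_ofP hF); rewrite rpred0. Qed.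

Lemma subfield1 F : subfield F -> F 1.
Proof. by case. Qed.

Lemma subfieldB F x y : subfield F -> F x -> F y -> F (x - y).
Proof. by move=> [_ h _]; exact: h. Qed.

Lemma subfieldN F x : subfield F -> F x -> F (- x).
Proof. by move=> hF Fx; rewrite -sub0r; apply: subfieldB (subfield0 hF) Fx. Qed.

Lemma subfieldD F x y : subfield F -> F x -> F y -> F (x + y).
Proof. by move=> hF Fx Fy; rewrite -[y]opprK; exact: subfieldB hF Fx (subfieldN hF Fy). Qed.

Lemma subfield_div F x y : subfield F -> F x -> F y -> F (x / y).
Proof. by move=> [_ _ h]; exact: h. Qed.

Lemma subfieldV F x : subfield F -> F x -> F x^-1.
Proof. by move=> hF Fx; rewrite -div1r; apply: subfield_div (subfield1 hF) Fx. Qed.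

Lemma subfieldM F x y : subfield F -> F x -> F y -> F (x * y).
Proof.
by move=> hF Fx Fy; rewrite -[y]invrK; exact: subfield_div hF Fx (subfieldV hF Fy).
Qed.

Lemma fgen_subfield (S : set U) : subfield (fgen S).
Proof.
split=> [A [[A1 _ _] _] //|x y Fx Fy A hA|x y Fx Fy A hA].
  by apply: subfieldB (proj1 hA) _ _; [apply: Fx|apply: Fy].
by apply: subfield_div (proj1 hA) _ _; [apply: Fx|apply: Fy].
Qed.

Lemma sub_fgen (S : set U) : S `<=` fgen S.
Proof. by move=> x Sx A [_]; apply. Qed.

Lemma fgen_min (S F : set U) : subfield F -> S `<=` F -> fgen S `<=` F.
Proof. by move=> hF SF x; apply. Qed.

Lemma polyOver_elt F (hF : subfield F) (p : {poly U}) :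
  (forall i, F p`_i) -> exists q : {poly elt hF}, p = map_poly val q.
Proof.
move=> Fp; have Fp' i : p`_i \in mem_of hF by apply/mem_ofP.
exists (\poly_(i < size p) Elt (Fp' i)); apply/polyP=> i.
rewrite coef_map coef_poly; case: ltnP => [_ //|/(nth_default 0)->].
by rewrite raddf0.
Qed.

Lemma algebraic_overE F (hF : subfield F) a :
  algebraic_over F a <-> algebraicOver (val : elt hF -> U) a.
Proof.
split=> [[p [p0 Fp pa]]|[p p0 pa]].
  have [q Dp] := polyOver_elt hF Fp; exists q; rewrite -?Dp //.
  by apply: contraNneq p0 => q0; rewrite Dp q0 raddf0.
exists (map_poly val p); split=> //; first by rewrite map_poly_eq0.
by move=> i; rewrite coef_map; apply/(mem_ofP hF)/valP.
Qed.

Definition acl E : set U := [set a | algebraic_over E a].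

Lemma sub_acl E : subfield E -> E `<=` acl E.
Proof.
move=> hE a /(mem_ofP hE) Ea; apply/(algebraic_overE hE).
exact: (algebraic_id (val : {rmorphism elt hE -> U}) (Elt Ea)).
Qed.

Lemma acl_mono E F : E `<=` F -> acl E `<=` acl F.
Proof. by move=> EF a [p [p0 Ep pa]]; exists p; split=> // i; apply: EF. Qed.

Lemma acl_subfield E : subfield E -> subfield (acl E).
Proof.
move=> hE; split=> [|x y /(algebraic_overE hE) Ax /(algebraic_overE hE) Ay|
  x y /(algebraic_overE hE) Ax /(algebraic_overE hE) Ay];
  apply/(algebraic_overE hE).
- exact: algebraic1.
- exact: algebraic_sub.
- exact: algebraic_div.
Qed.

Lemma acl_idem E : subfield E -> acl (acl E) `<=` acl E.
Proof.
move=> hE a [p [p0 Ep pa]]; apply/(algebraic_overE hE)/integral_algebraic.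
apply: integral_root p0 pa _; apply/integral_poly => i.
exact/integral_algebraic/(algebraic_overE hE)/Ep.
Qed.

End AlgebraicClosure.

Section MpolyInduction.
Variables (n : nat) (R : comNzRingType).

(** Induction along the ring operations; [S] records where the coefficients
    live. *)
Lemma mpoly_ring_ind (S : set R) (P : mpoly n R -> Prop) :
    P 0 -> P 1 -> (forall c, S c -> P (mpolyC n c)) -> (forall i, P (mpolyX R (mnm1 i))) ->
    (forall p q, P p -> P q -> P (p + q)) ->
    (forall p q, P p -> P q -> P (p * q)) ->
  forall p, (forall m, S (mcoeff m p)) -> P p.
Proof.
move=> P0 P1 PC PX PD PM p Sp; rewrite [p]mpolyE.
apply: big_ind => // m _; rewrite -mul_mpolyC; apply: (PM _ _ (PC _ (Sp m))).
rewrite mpolyXE_id; apply: big_ind => // i _.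
by elim: (m i) => [|k IH] //; rewrite exprS; apply: PM.
Qed.

End MpolyInduction.

(** * Singling out the last variable of a polynomial *)

Section LastVariable.
Variables (n : nat) (R : comNzRingType).
Implicit Types (P : mpoly n.+1 R) (Q : {poly mpoly n R}).

Definition widen_last (i : 'I_n) : 'I_n.+1 := widen_ord (leqnSn n) i.

Lemma ord_lastP (i : 'I_n.+1) :
  i = ord_max \/ exists j, i = widen_last j.
Proof.
case: (unliftP ord_max i) => [j ->|->]; [right|by left].
by exists j; apply/val_inj; rewrite /= /bump leqNgt ltn_ord.
Qed.

Lemma muni_lastX : muni (mpolyX R (mnm1 (ord_max : 'I_n.+1))) = 'X.
Proof.
rewrite muniE msuppX big_seq1 mcoeffX eqxx scale1r.
rewrite mnm1E eqxx expr1.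
set m := (X in mpolyX R X); suff -> : m = mnm0 by rewrite mpolyX0 scale1r.
by apply/mnmP=> j; rewrite mnmE mnm1E mnm0E -val_eqE /= gtn_eqF.
Qed.

Lemma muni_widenX (i : 'I_n) :
  muni (mpolyX R (mnm1 (widen_last i))) = (mpolyX R (mnm1 i))%:P.
Proof.
rewrite muniE msuppX big_seq1 mcoeffX eqxx scale1r.
rewrite mnm1E -val_eqE /= ltn_eqF // expr0.
set m := (X in mpolyX R X); suff -> : m = mnm1 i by rewrite alg_polyC.
by apply/mnmP=> j; rewrite mnmE !mnm1E -!val_eqE /=.
Qed.

Lemma muni_mwiden (c : mpoly n R) : muni (mwiden c) = c%:P.
Proof.
apply: (mpoly_ring_ind (S := setT)
  (P := fun c => muni (mwiden c) = c%:P)) => [|||i|p q Hp Hq|p q Hp Hq|//].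
- by rewrite !raddf0.
- by rewrite !rmorph1.
- by move=> a _; rewrite mwidenC muniC.
- by rewrite mwidenX mnmwiden1 muni_widenX.
- by rewrite !raddfD /= Hp Hq.
- by rewrite !rmorphM /= Hp Hq.
Qed.

(** The inverse of [muni]. *)
Definition unmuni Q : mpoly n.+1 R :=
  (map_poly (@mwiden n R) Q).[mpolyX R (mnm1 ord_max)].

Lemma unmuniK : cancel unmuni (@muni n R).
Proof.
move=> Q; rewrite /unmuni -horner_map /= muni_lastX -map_poly_comp /=.
rewrite (eq_map_poly (g := polyC)); last exact: muni_mwiden.
by have := comp_polyXr Q; rewrite /comp_poly.
Qed.

Lemma unmuniC c : unmuni c%:P = mwiden c.
Proof. by rewrite /unmuni map_polyC hornerC. Qed.

Lemma unmuniX : unmuni 'X = mpolyX R (mnm1 ord_max).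
Proof. by rewrite /unmuni map_polyX hornerX. Qed.

Lemma unmuniD Q1 Q2 : unmuni (Q1 + Q2) = unmuni Q1 + unmuni Q2.
Proof. by rewrite /unmuni rmorphD hornerD. Qed.

Lemma unmuniM Q1 Q2 : unmuni (Q1 * Q2) = unmuni Q1 * unmuni Q2.
Proof. by rewrite /unmuni rmorphM hornerM. Qed.

Lemma muniK : cancel (@muni n R) unmuni.
Proof.
move=> P; apply: (mpoly_ring_ind (S := setT)
  (P := fun P => unmuni (muni P) = P)) => [|||i|p q Hp Hq|p q Hp Hq|//].
- by rewrite muni0 -polyC0 [LHS]unmuniC mwiden0.
- by rewrite muni1 -polyC1 [LHS]unmuniC mwiden1.
- by move=> c _; rewrite muniC [LHS]unmuniC mwidenC.
- have [->|[j ->]] := ord_lastP i; first by rewrite muni_lastX unmuniX.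
  by rewrite muni_widenX [LHS]unmuniC mwidenX mnmwiden1.
- by rewrite muniD [LHS]unmuniD; congr (_ + _).
- by rewrite muniM [LHS]unmuniM; congr (_ * _).
Qed.

Lemma meval_muni (a : 'I_n.+1 -> R) P :
  meval a P = (map_poly (meval (a \o widen_last)) (muni P)).[a ord_max].
Proof.
apply: (mpoly_ring_ind (S := setT) (P := fun P =>
  meval a P = (map_poly (meval (a \o widen_last)) (muni P)).[a ord_max]))
  => [|||i|p q Hp Hq|p q Hp Hq|//].
- by rewrite muni0 meval0 rmorph0 horner0.
- by rewrite muni1 meval1 rmorph1 hornerC.
- by move=> c _; rewrite muniC map_polyC hornerC /= !mevalC.
- have [->|[j ->]] := ord_lastP i.
    by rewrite muni_lastX map_polyX hornerX mevalXU.
  by rewrite muni_widenX map_polyC hornerC /= !mevalXU.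
- by rewrite muniD [in RHS]rmorphD hornerD [LHS]mevalD Hp Hq.
- by rewrite muniM [in RHS]rmorphM hornerM [LHS]mevalM Hp Hq.
Qed.

Lemma meval_unmuni (a : 'I_n.+1 -> R) Q :
  meval a (unmuni Q) = (map_poly (meval (a \o widen_last)) Q).[a ord_max].
Proof. by rewrite meval_muni unmuniK. Qed.

Lemma meval_mwiden (a : 'I_n.+1 -> R) (c : mpoly n R) :
  meval a (mwiden c) = meval (a \o widen_last) c.
Proof. by rewrite -unmuniC meval_unmuni map_polyC hornerC. Qed.

End LastVariable.

Section LastVariableOver.
Variables (n : nat) (R : comNzRingType) (S : subringClosed R).

Lemma muni_over (P : mpoly n.+1 R) : P \is a mpolyOver n.+1 S ->
  muni P \is a polyOver (@mpolyOver_pred n R S).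
Proof.
move/mpolyOverP=> SP; apply: (mpoly_ring_ind (S := [set c | c \in S])
  (P := fun P => muni P \is a polyOver (@mpolyOver_pred n R S)))
  => [|||i|p q Hp Hq|p q Hp Hq|//].
- by rewrite muni0; apply: rpred0.
- by rewrite muni1; apply: rpred1.
- by move=> c Sc; rewrite muniC polyOverC; rewrite -[_ \in _]/(_ \in mpolyOver n S) mpolyOverC.
- have [->|[j ->]] := ord_lastP i; first by rewrite muni_lastX polyOverX.
  by rewrite muni_widenX polyOverC; apply: mpolyOverX.
- by rewrite muniD; exact: rpredD Hp Hq.
- by rewrite muniM; exact: rpredM Hp Hq.
Qed.

Lemma mwiden_over (c : mpoly n R) : c \is a mpolyOver n S ->
  mwiden c \is a mpolyOver n.+1 S.
Proof.
move/mpolyOverP=> SP; apply: (mpoly_ring_ind (S := [set c | c \in S])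
  (P := fun c => mwiden c \is a mpolyOver n.+1 S))
  => [|||i|p q Hp Hq|p q Hp Hq|//].
- by rewrite mwiden0; apply: rpred0.
- by rewrite mwiden1; apply: rpred1.
- by move=> a Sa; rewrite mwidenC mpolyOverC.
- by rewrite mwidenX mnmwiden1 mpolyOverX.
- by rewrite mwidenD; exact: rpredD Hp Hq.
- by rewrite mwidenM; exact: rpredM Hp Hq.
Qed.

Lemma unmuni_over (Q : {poly mpoly n R}) : Q \is a polyOver (@mpolyOver_pred n R S) ->
  unmuni Q \is a mpolyOver n.+1 S.
Proof.
move/polyOverP=> SQ; rewrite /unmuni horner_poly.
by apply: rpred_sum => i _; rewrite rpredM ?rpredX ?mpolyOverX ?mwiden_over.
Qed.

End LastVariableOver.

(** * Transcendence degree *)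

Section TranscendenceDegree.
Variable U : fieldType.
Implicit Types E F : set U.

Lemma mpoly_overP F (hF : subfield F) n (P : mpoly n U) :
  mpoly_over F P <-> P \is a mpolyOver n (mem_of hF).
Proof.
by split=> [FP|/mpolyOverP FP m]; [apply/mpolyOverP=> m|]; apply/(mem_ofP hF).
Qed.

Lemma fgen_fgenU (A B : set U) : fgen (fgen A `|` B) = fgen (A `|` B).
Proof.
apply/seteqP; split; apply: fgen_min (@fgen_subfield _ _) _.
  move=> x [|Bx]; last by apply: sub_fgen; right.
  by apply: fgen_min (@fgen_subfield _ _) _ _ => y Ay; apply: sub_fgen; left.
move=> x [Ax|Bx]; apply: sub_fgen; last by right.
by left; apply: sub_fgen.
Qed.

Lemma fgen_id E : subfield E -> fgen E = E.
Proof.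
by move=> hE; apply/seteqP; split; [apply: fgen_min|apply: sub_fgen].
Qed.

Lemma meval_mpoly_over F n (a : 'I_n -> U) (P : mpoly n U) :
  subfield F -> (forall i, F (a i)) -> mpoly_over F P -> F (meval a P).
Proof.
move=> hF Fa /(mpoly_overP hF) FP; apply/(mem_ofP hF).
by apply: rpred_mhorner FP _ _; apply/forallP=> i; apply/(mem_ofP hF).
Qed.

(** Quotients of values of polynomials already form a field. *)
Lemma fgen_frac E n (a : 'I_n -> U) x : subfield E ->
    fgen (E `|` range a) x ->
  exists N D : mpoly n U, [/\ mpoly_over E N, mpoly_over E D,
    meval a D != 0 & meval a D * x = meval a N].
Proof.
move=> hE; pose F : set U := [set x | exists N D : mpoly n U,
  [/\ mpoly_over E N, mpoly_over E D,
      meval a D != 0 & meval a D * x = meval a N]].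
have overE N := mpoly_overP hE N.
have E1 : mpoly_over E (1 : mpoly n U) by apply/overE/rpred1.
have hF : subfield F; last apply: (fgen_min (F := F)) => //.
  split=> [|x1 x2 [N1 [D1 [EN1 ED1 D1a N1a]]] [N2 [D2 [EN2 ED2 D2a N2a]]]|
    x1 x2 [N1 [D1 [EN1 ED1 D1a N1a]]] [N2 [D2 [EN2 ED2 D2a N2a]]]].
  - by exists 1, 1; rewrite meval1 mulr1 oner_eq0.
  - exists (N1 * D2 - N2 * D1), (D1 * D2).
    rewrite mevalB !mevalM -N1a -N2a mulf_neq0 //.
    split=> //; try by ring.
      by apply/overE; rewrite rpredB ?rpredM //; apply/overE.
    by apply/overE; rewrite rpredM //; apply/overE.
  - have [->|x20] := eqVneq x2 0.
      exists 0, 1; rewrite meval1 meval0 invr0 !mulr0 oner_eq0.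
      by split=> //; apply/overE/rpred0.
    exists (N1 * D2), (D1 * N2); rewrite !mevalM -N1a -N2a !mulf_neq0 //.
    split=> //; try by field.
      by apply/overE; rewrite rpredM //; apply/overE.
    by apply/overE; rewrite rpredM //; apply/overE.
move=> y [Ey|[i _ <-]].
  exists (mpolyC n y), 1; rewrite meval1 mevalC mul1r oner_eq0.
  by split=> //; apply/overE; rewrite mpolyOverC; apply/mem_ofP.
exists (mpolyX U (mnm1 i)), 1; rewrite meval1 mevalXU mul1r oner_eq0.
by split=> //; apply/overE; rewrite mpolyOverX.
Qed.

Lemma fgen_common_denom E n (a : 'I_n -> U) (p : {poly U}) : subfield E ->
    (forall i, fgen (E `|` range a) p`_i) ->
  exists (D : mpoly n U) (Q : {poly mpoly n U}),
    [/\ meval a D != 0, forall i, mpoly_over E Q`_i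
      & (meval a D) *: p = map_poly (meval a) Q].
Proof.
move=> hE; have overE N := @mpoly_overP E hE n N.
suff H : (forall i, fgen (E `|` range a) p`_i) ->
  exists (D : mpoly n U) (Q : {poly mpoly n U}),
    [/\ meval a D != 0, mpoly_over E D, forall i, mpoly_over E Q`_i
      & (meval a D) *: p = map_poly (meval a) Q].
  by move=> /H[D [Q [? _ ? ?]]]; exists D, Q.
elim/poly_ind: p => [_|p c IH Fp].
  exists 1, 0; rewrite meval1 oner_eq0 scaler0 raddf0; split=> //.
    by apply/overE/rpred1.
  by move=> i; rewrite coef0; apply/overE/rpred0.
have [|D [Q [Da ED EQ DQ]]] := IH.
  by move=> i; have := Fp i.+1; rewrite coefD coefMX coefC addr0.
have := Fp 0%N; rewrite coefD coefMX coefC add0r.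
case/(fgen_frac hE) => N [D' [EN ED' D'a DN]].
exists (D * D'), (D'%:P * Q * 'X + (D * N)%:P); rewrite mevalM mulf_neq0 //.
split=> //; first by apply/overE/rpredM; apply/overE.
- move=> i; rewrite coefD coefMX coefC coefCM; apply/overE.
  apply: rpredD; case: eqP => _; try exact: rpred0.
    by apply: rpredM; apply/overE.
  by apply: rpredM; apply/overE.
rewrite rmorphD !rmorphM /= !map_polyC map_polyX /= -DQ -DN scalerDr.
by rewrite -!mul_polyC !polyCM; ring.
Qed.

(** Grouping by powers of the last variable turns a relation among all the
    elements into an equation for the last one; clearing denominators goes the
    other way. *)
Lemma alg_indep_last E n (a : 'I_n.+1 -> U) : subfield E ->
  alg_indep E a <->
    alg_indep E (a \o @widen_last n) /\
    ~ acl (fgen (E `|` range (a \o @widen_last n))) (a ord_max).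
Proof.
move=> hE; set a' := a \o _; have overE N := mpoly_overP hE N.
split=> [ind|[ind trans] P EP Pa].
  have ind' : alg_indep E a'.
    move=> P /overE EP Pa; apply/inj_mwiden; rewrite mwiden0; apply: ind.
      by apply/overE/mwiden_over.
    by rewrite meval_mwiden.
  split=> // -[p [p0 Fp pa]]; have [D [Q [Da EQ DQ]]] := fgen_common_denom hE Fp.
  have Q0 : unmuni Q = 0.
    apply: ind.
      by apply/overE/unmuni_over/polyOverP => i; apply/overE/EQ.
    by rewrite meval_unmuni -DQ hornerZ (rootP pa) mulr0.
  move/(congr1 (@muni n U)): Q0; rewrite unmuniK muni0 => Q0.
  move: DQ; rewrite Q0 raddf0 => /eqP.
  by rewrite scaler_eq0 (negbTE Da) (negbTE p0).
have EmP : muni P \is a polyOver (@mpolyOver_pred n U (mem_of hE)).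
  exact/muni_over/overE.
have/polyOverP EmP' := EmP.
have mP0 : map_poly (meval a') (muni P) = 0.
  apply/eqP; apply: contra_notT trans => mP0.
  exists (map_poly (meval a') (muni P)); split=> //.
    move=> i; rewrite coef_map /=; apply: meval_mpoly_over.
    - exact: fgen_subfield.
    - by move=> j; apply: sub_fgen; right; exists j.
    - by have /overE EPi := EmP' i; move=> m; apply: sub_fgen; left; apply: EPi.
  by rewrite /root -meval_muni Pa.
rewrite -[P]muniK; suff -> : muni P = 0 by rewrite -polyC0 unmuniC mwiden0.
apply/polyP=> i; rewrite coef0; apply: ind; first exact/overE/EmP'.
by have := congr1 (fun p : {poly U} => p`_i) mP0; rewrite coef_map coef0.
Qed.

(** Algebraic independence in a form that lets elements be exchanged one at a
    time. *)
Fixpoint seq_indep E (s : seq U) : Prop :=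
  if s is x :: s' then ~ acl E x /\ seq_indep (fgen (E `|` [set x])) s'
  else True.

Lemma set_cons (x : U) s : [set` x :: s] = [set x] `|` [set` s].
Proof.
apply/seteqP; split=> y /=; rewrite in_cons.
  by case/orP=> [/eqP->|ys]; [left|right].
by case=> [->|->]; rewrite ?eqxx ?orbT.
Qed.

Lemma fgen_cons E x s :
  fgen (fgen (E `|` [set x]) `|` [set` s]) = fgen (E `|` [set` x :: s]).
Proof. by rewrite fgen_fgenU set_cons setUA. Qed.

Lemma seq_indep_rcons E s x : subfield E ->
  seq_indep E (rcons s x) <->
    seq_indep E s /\ ~ acl (fgen (E `|` [set` s])) x.
Proof.
elim: s E => [|y s IH] E hE /=.
  rewrite (_ : [set` [::]] = set0) ?setU0 ?fgen_id //; first by intuition.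
  by apply/seteqP; split.
have /IH-> := @fgen_subfield U (E `|` [set y]).
by rewrite fgen_cons; intuition.
Qed.

Lemma alg_indep_seq E n (a : 'I_n -> U) : subfield E ->
  alg_indep E a <-> seq_indep E (map a (enum 'I_n)).
Proof.
move=> hE; elim: n a => [|n IH] a.
  rewrite (_ : enum 'I_0 = [::]); last by apply/size0nil; rewrite size_enum_ord.
  split=> // _ P EP; rewrite [P]mpolyE; move=> P0.
  suff c0 : mcoeff mnm0 P = 0.
    by apply: big1 => m _; rewrite (_ : m = mnm0) ?c0 ?scale0r //; apply/mnmP => -[].
  move: P0; rewrite raddf_sum /= (eq_bigr (fun m => mcoeff m P)); last first.
    by move=> m _; rewrite mevalZ mevalX big_ord0 mulr1.
  rewrite (eq_bigr (fun _ => mcoeff mnm0 P)); last first.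
    by move=> m _; congr (mcoeff _ P); apply/mnmP => -[].
  case E0 : (msupp P) (msupp_uniq P) => [|m [|m' s]] /=.
  - by have /eqP -> : mcoeff mnm0 P == 0 by rewrite mcoeff_eq0 E0.
  - by rewrite big_seq1.
  - rewrite (_ : m = m') ?in_cons ?eqxx //; apply/mnmP=> -[] //.
rewrite alg_indep_last // enum_ordSr map_rcons seq_indep_rcons // IH.
have -> : map a [seq widen_ord (leqnSn n) i | i <- enum 'I_n] =
  map (a \o @widen_last n) (enum 'I_n) by rewrite -map_comp.
suff -> : [set` map (a \o @widen_last n) (enum 'I_n)] =
  range (a \o @widen_last n) by [].
apply/seteqP; split=> y /= => [/mapP[i _ ->]|[i _ <-]]; first by exists i.
by apply/mapP; exists i; rewrite ?mem_enum.
Qed.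

(** Independence survives both algebraic extension and restriction of the base
    field; the two are treated together. *)
Lemma seq_indep_acl E F s : subfield E -> subfield F -> F `<=` acl E ->
  seq_indep E s -> seq_indep F s.
Proof.
elim: s E F => [|x s IH] E F hE hF FE //= [Ex Es]; split.
  move=> Fx; apply/Ex/(acl_idem hE); exact: acl_mono FE _ Fx.
apply: IH Es; try exact: fgen_subfield.
apply: fgen_min; first exact/acl_subfield/fgen_subfield.
move=> y [/FE|->]; last by apply: sub_acl (@fgen_subfield _ _) _ _; apply: sub_fgen; right.
by apply: acl_mono => z Ez; apply: sub_fgen; left.
Qed.

End TranscendenceDegree.

Section TranscendenceDegreeBounds.
Variable U : fieldType.
Implicit Types E F L : set U.

Lemma meval_msym n (v : 'I_n -> U) (s : 'S_n) (P : mpoly n U) :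
  meval v (msym s P) = meval (v \o s) P.
Proof.
apply: (mpoly_ring_ind (S := setT)
  (P := fun P => meval v (msym s P) = meval (v \o s) P))
  => [|||i|p q Hp Hq|p q Hp Hq|//].
- by rewrite msym0 !meval0.
- by rewrite msym1 !meval1.
- by move=> c _; rewrite /msym mmapC !mevalC.
- by rewrite /msym mmapX mmap1U !mevalXU.
- by rewrite msymD [LHS]mevalD [RHS]mevalD Hp Hq.
- by rewrite msymM [LHS]mevalM [RHS]mevalM Hp Hq.
Qed.

Lemma alg_indep_perm E n (a : 'I_n -> U) (s : 'S_n) :
  alg_indep E a -> alg_indep E (a \o s).
Proof.
move=> ind P EP Pa; apply: (@inj_msym _ _ s); rewrite msym0; apply: ind.
  by move=> m; rewrite mcoeff_sym; apply: EP.
by rewrite meval_msym.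
Qed.

Lemma seq_indep_swap E x y : subfield E ->
  seq_indep E [:: x; y] -> seq_indep E [:: y; x].
Proof.
move=> hE; pose a u v (i : 'I_2) : U := if i == ord0 then u else v.
have Da u v : [:: u; v] = map (a u v) (enum 'I_2).
  by rewrite enum_ordSl enum_ordSl /= -(map_comp _ _ (enum 'I_0))
     (_ : enum 'I_0 = [::]) //; apply/size0nil; rewrite size_enum_ord.
rewrite !Da => /(alg_indep_seq _ hE) ind.
have {}ind := alg_indep_perm (s := tperm ord0 ord_max) ind.
apply/(alg_indep_seq _ hE); suff <- : a x y \o tperm ord0 ord_max = a y x by [].
apply/funext => i; rewrite /a /=; case: tpermP => [->|->|] //.
case: i => -[|[|k]] lt //= h0 h1; first by case: h0; apply: val_inj.
by case: h1; apply: val_inj.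
Qed.

(** Independence of a pair does not depend on its order, and this symmetry is
    the exchange property. *)
Lemma acl_exchange E b c : subfield E ->
  acl (fgen (E `|` [set c])) b -> ~ acl E b -> acl (fgen (E `|` [set b])) c.
Proof.
move=> hE bc nb; apply: contrapT => nc.
by have [|_ []] := @seq_indep_swap E b c hE.
Qed.

(** If [b] becomes algebraic when [c] is adjoined, exchange makes [c] algebraic
    over the field generated by [b], so the members after [b] stay
    independent. *)
Lemma seq_indep_adjoin E c s : subfield E -> seq_indep E s ->
  exists s', [/\ seq_indep (fgen (E `|` [set c])) s', {subset s' <= s}
    & (size s <= (size s').+1)%N].
Proof.
elim: s E => [|b s IH] E hE /=; first by exists [::].
case=> nb Es; have [bc|nbc] := pselect (acl (fgen (E `|` [set c])) b).
  exists s; split=> // [|x xs]; last by rewrite in_cons xs orbT.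
  apply: seq_indep_acl Es; try exact: fgen_subfield.
  apply: fgen_min; first exact/acl_subfield/fgen_subfield.
  move=> x [Ex|->]; last exact: acl_exchange.
  by apply: sub_acl; [apply: fgen_subfield|apply: sub_fgen; left].
have [s' [Es' ss' zs]] := IH _ (@fgen_subfield _ _) Es.
exists (b :: s'); split=> //.
  by split=> //; move: Es'; rewrite !fgen_fgenU setUAC.
by move=> x; rewrite !in_cons => /orP[->|/ss' ->]; rewrite ?orbT.
Qed.

(** Steinitz: the members of [c] are adjoined one by one, and each of them costs
    at most one member of [s]. *)
Lemma seq_indep_size E s c : subfield E -> seq_indep E s ->
  (forall x, x \in s -> acl (fgen (E `|` [set` c])) x) -> (size s <= size c)%N.
Proof.
elim: c E s => [|y c IH] E s hE Es sc.
  case: s Es sc => [|x s] //= [nx _] /(_ x); rewrite in_cons eqxx => /(_ isT) ax.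
  case: nx; move: ax; rewrite (_ : [set` [::]] = set0) ?setU0 ?fgen_id //.
  by apply/seteqP; split.
have [s' [Es' ss' zs]] := seq_indep_adjoin y hE Es.
apply: leq_trans zs _; rewrite ltnS; apply: IH Es' _ => [|x /ss' /sc].
  exact: fgen_subfield.
by rewrite fgen_cons.
Qed.

Lemma alg_indep_size E n (a : 'I_n -> U) (c : seq U) : subfield E ->
  alg_indep E a -> (forall i, acl (fgen (E `|` [set` c])) (a i)) ->
  (n <= size c)%N.
Proof.
move=> hE /(alg_indep_seq _ hE) Ea ac.
have := seq_indep_size hE Ea; rewrite size_map size_enum_ord; apply.
by move=> x /mapP[i _ ->].
Qed.

(** [L], hence also [acl L], is algebraic over the field generated by a maximal
    independent family of [L]. *)
Lemma trdeg_le_acl E L r n (a : 'I_n -> U) : subfield E -> trdeg_le E L r ->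
  alg_indep E a -> (forall i, acl L (a i)) -> (n <= r)%N.
Proof.
move=> hE trL ind La.
pose P t := `[< exists s, [/\ size s = t, seq_indep E s &
  forall x, x \in s -> L x] >].
have exP : exists t, P t by exists 0%N; apply/asboolP; exists [::].
have ubP t : P t -> (t <= r)%N.
  move/asboolP=> [s [<- Es sL]]; apply: (trL _ (fun i : 'I_(size s) => s`_i)).
    by move=> i; apply/sL/mem_nth.
  apply/(alg_indep_seq _ hE); rewrite (_ : map _ _ = s) //.
  by rewrite -[RHS](mkseq_nth 0) /mkseq -val_enum_ord -map_comp.
case: (ex_maxnP exP ubP) => t Pt max_t; apply: leq_trans (ubP t Pt).
case/asboolP: Pt => s [zs Es sL]; rewrite -zs; apply: (alg_indep_size hE ind) => i.
have hF := @fgen_subfield U (E `|` [set` s]).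
apply: (acl_idem hF); apply: acl_mono (La i) => x Lx; apply: contrapT => nx.
suff /max_t : P (size (rcons s x)).
  by rewrite size_rcons zs ltnn.
apply/asboolP; exists (rcons s x); split=> //; first by apply/(seq_indep_rcons s x hE).
by move=> y; rewrite mem_rcons in_cons => /orP[/eqP->|/sL].
Qed.

End TranscendenceDegreeBounds.

(** * Pseudo-division *)

Lemma deriv_neq0 (R : idomainType) (p : {poly R}) :
  [pchar R] =i pred0 -> (1 < size p)%N -> p^`() != 0.
Proof.
move=> char0 zp; have : lead_coef p != 0.
  by rewrite lead_coef_eq0 -size_poly_gt0 ltnW.
apply: contra_neq => p'0; rewrite /lead_coef.
have /polyP/(_ (size p).-2) := p'0; rewrite coef_deriv coef0.
rewrite (_ : (size p).-2.+1 = (size p).-1); last by case: (size p) zp => [|[]].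
move/eqP; rewrite -mulr_natl mulf_eq0 (iffLR (pcharf0P _) char0).
by case/orP=> [|/eqP //]; case: (size p) zp => [|[]].
Qed.

Section PseudoDivision.
Variables (R : comNzRingType) (S : subringClosed R) (U : fieldType) (psi : R -> U).
Hypotheses (psi1 : psi 1 = 1)
  (psiB : {in S &, forall x y, psi (x - y) = psi x - psi y})
  (psiM : {in S &, forall x y, psi (x * y) = psi x * psi y}).
Implicit Types P Q G : {poly R}.

Lemma part_morph0 : psi 0 = 0.
Proof. by rewrite -(subrr (1 : R)) psiB ?rpred1 // subrr. Qed.

Lemma part_morphN : {in S, forall x, psi (- x) = - psi x}.
Proof. by move=> x Sx; rewrite -sub0r psiB ?rpred0 // part_morph0 sub0r. Qed.

Lemma part_morphD : {in S &, forall x y, psi (x + y) = psi x + psi y}.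
Proof.
by move=> x y Sx Sy; rewrite -[y]opprK psiB ?rpredN // part_morphN ?rpredN ?opprK.
Qed.

Lemma coef_part P i : (map_poly psi P)`_i = psi P`_i.
Proof. exact/coef_map_id0/part_morph0. Qed.

Lemma part_polyB : {in polyOver S &, forall P Q,
  map_poly psi (P - Q) = map_poly psi P - map_poly psi Q}.
Proof.
move=> P Q /polyOverP SP /polyOverP SQ; apply/polyP=> i.
by rewrite coefB !coef_part coefB psiB.
Qed.

Lemma part_polyD : {in polyOver S &, forall P Q,
  map_poly psi (P + Q) = map_poly psi P + map_poly psi Q}.
Proof.
move=> P Q /polyOverP SP /polyOverP SQ; apply/polyP=> i.
by rewrite coefD !coef_part coefD part_morphD.
Qed.

Lemma part_polyM : {in polyOver S &, forall P Q,
  map_poly psi (P * Q) = map_poly psi P * map_poly psi Q}.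
Proof.
move=> P Q /polyOverP SP /polyOverP SQ; apply/polyP=> i.
rewrite coef_part !coefM.
have : (\sum_(j < i.+1) P`_j * Q`_(i - j) \in S) /\
   psi (\sum_(j < i.+1) P`_j * Q`_(i - j)) =
   \sum_(j < i.+1) (map_poly psi P)`_j * (map_poly psi Q)`_(i - j).
  apply: (big_rec2 (fun x y => x \in S /\ psi x = y)).
    by rewrite rpred0 part_morph0.
  move=> j x y _ [Sy <-]; rewrite rpredD ?rpredM // part_morphD ?rpredM //.
  by rewrite psiM // !coef_part.
by case.
Qed.

Lemma part_polyC c : map_poly psi c%:P = (psi c)%:P.
Proof.
by apply/polyP=> i; rewrite coef_part !coefC; case: eqP; rewrite ?part_morph0.
Qed.

Lemma part_polyXn n : map_poly psi 'X^n = 'X^n.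
Proof.
apply/polyP=> i; rewrite coef_part !coefXn.
by case: eqP => _; rewrite ?psi1 ?part_morph0.
Qed.

Lemma size_sub_lead (p q : {poly U}) n : (size p <= n.+1)%N -> (size q <= n.+1)%N ->
  p`_n = q`_n -> (size (p - q)%R <= n)%N.
Proof.
move=> zp zq pq; apply/leq_sizeP => j; rewrite leq_eqVlt => /orP[/eqP <-|nj].
  by rewrite coefB pq subrr.
by rewrite coefB !nth_default ?subrr //; apply: leq_trans nj.
Qed.

(** Division with remainder whose sizes are measured after applying [psi], so
    that leading coefficients killed by [psi] are ignored. *)
Lemma pseudo_div Q G : Q \is a polyOver S -> G \is a polyOver S ->
    map_poly psi G != 0 ->
  exists c A Rm, [/\ c \in S, psi c != 0, A \is a polyOver S,
    Rm \is a polyOver S & c%:P * Q = A * G + Rm /\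
    (size (map_poly psi Rm) < size (map_poly psi G))%N].
Proof.
move=> SQ SG G0; have [m] := ubnP (size (map_poly psi Q)).
elim: m Q SQ => // m IH Q SQ; rewrite ltnS => zQ.
have [small|big] := ltnP (size (map_poly psi Q)) (size (map_poly psi G)).
  exists 1, 0, Q; rewrite mul1r mul0r add0r psi1 oner_eq0 rpred1.
  by split=> //; apply: rpred0.
set n := (size (map_poly psi Q)).-1; set g := G`_(size (map_poly psi G)).-1.
have gpos : (0 < size (map_poly psi G))%N by rewrite size_poly_gt0.
have zQn : size (map_poly psi Q) = n.+1.
  by rewrite /n prednK // (leq_trans gpos).
have Sg : g \in S by apply/polyOverP.
have g0 : psi g != 0.
  by rewrite -coef_part -/(lead_coef _) lead_coef_eq0.
set d := (size (map_poly psi Q) - size (map_poly psi G))%N.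
have Sqd : (Q`_n)%:P * 'X^d \is a polyOver S.
  by rewrite rpredM ?polyOverXn // polyOverC; apply/polyOverP.
(* The coefficients of [Q] beyond [n] are killed by [psi], so that cancelling
   the coefficient at [n] lowers the size. *)
pose Q' := g%:P * Q - (Q`_n)%:P * 'X^d * G.
have Sgp : g%:P \is a polyOver S by rewrite polyOverC.
have SQ' : Q' \is a polyOver S by rewrite rpredB // rpredM.
have SQn : (Q`_n)%:P \is a polyOver S by rewrite polyOverC; apply/polyOverP.
have DQ' : map_poly psi Q' =
    (psi g)%:P * map_poly psi Q - (psi Q`_n)%:P * 'X^d * map_poly psi G.
  rewrite /Q' part_polyB; [|exact: rpredM|exact: rpredM].
  rewrite (part_polyM Sgp SQ) (part_polyM Sqd SG).
  by rewrite (part_polyM SQn (polyOverXn _ _)) !part_polyC part_polyXn.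
have [] := IH Q' SQ'.
  apply: leq_trans zQ; rewrite zQn ltnS DQ'; apply: size_sub_lead.
  - by rewrite mul_polyC -zQn size_scale.
  - rewrite -mulrA mul_polyC; apply: leq_trans (size_scale_leq _ _) _.
    rewrite mulrC size_mulXn // -?size_poly_gt0 // -zQn /d.
    by rewrite subnK.
  rewrite coefCM -mulrA coefCM coef_part mulrC; congr (_ * _).
  rewrite coefXnM coef_part -/g ltnNge.
  have -> : (d <= n)%N.
    by rewrite /d zQn; case: (size _) gpos => // s _; rewrite subSS leq_subr.
  congr (psi G`_ _); rewrite /d zQn.
  move: big gpos; rewrite zQn; case: (size _) => // s.
  by rewrite ltnS subSS /= => sn _; rewrite subKn.
move=> c [A [Rm [Sc c0 SA SRm [D zR]]]].
exists (c * g), (A + c%:P * ((Q`_n)%:P * 'X^d)), Rm; split=> //.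
- by rewrite rpredM.
- by rewrite psiM // mulf_neq0.
- by rewrite rpredD // rpredM // polyOverC.
split=> //; rewrite polyCM mulrDl -addrA [_ + Rm]addrC addrA -D /Q'; ring.
Qed.

End PseudoDivision.

(** * Generic zeros of differential polynomials *)

Section Derivations.
Variables (U : fieldType) (delta : U -> U) (hd : derivation delta).

Lemma derD x y : delta (x + y) = delta x + delta y.
Proof. exact: (proj1 hd). Qed.

Lemma derM x y : delta (x * y) = delta x * y + x * delta y.
Proof. exact: (proj2 hd). Qed.

Lemma der0 : delta 0 = 0.
Proof. by apply: (addrI (delta 0)); rewrite -derD !addr0. Qed.

Lemma der1 : delta 1 = 0.
Proof.
by have /esym/eqP := derM 1 1; rewrite mulr1 mulr1 mul1r -subr_eq0 addrK => /eqP.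
Qed.

Lemma derN x : delta (- x) = - delta x.
Proof. by apply: (addrI (delta x)); rewrite -derD !subrr der0. Qed.

Lemma derB x y : delta (x - y) = delta x - delta y.
Proof. by rewrite derD derN. Qed.

End Derivations.

Definition jet (U : fieldType) (delta : U -> U) (k : nat) (z : U) : 'I_k -> U :=
  fun i => iter i delta z.
Arguments jet {U} delta k z.

Lemma mpoly_pchar0 (U : fieldType) k :
  [pchar U] =i pred0 -> [pchar mpoly k U] =i pred0.
Proof.
move=> char0; apply/pcharf0P => n.
by rewrite -(rmorph_nat (@mpolyC k U)) mpolyC_eq0; apply: (iffLR (pcharf0P _)).
Qed.

(** [evalc] evaluates polynomials in [z, ..., delta^(k-1) z], and [evalj]
    polynomials in [delta^k z] over these. Both are sealed, so that evaluations
    of different polynomials are never compared by computation. *)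
HB.lock Definition evalc (U : fieldType) (delta : U -> U) (k : nat) (z : U)
    (c : mpoly k U) : U := meval (jet delta k z) c.

HB.lock Definition evalj (U : fieldType) (delta : U -> U) (k : nat) (z : U)
    (Q : {poly mpoly k U}) : U :=
  (map_poly (meval (jet delta k z)) Q).[iter k delta z].

Section GenericZeros.
Variables (U : fieldType) (delta : U -> U) (hd : derivation delta).
Hypothesis char0 : [pchar U] =i pred0.
Variables (F : set U) (hF : subfield F) (dF : forall x, F x -> F (delta x)).
Variables (k : nat) (f : U).
Hypothesis ind : alg_indep F (jet delta k f).

Notation over := (@mpolyOver_pred k U (mem_of hF)).
Notation jetk := (jet delta k).
Notation evalc := (@evalc U delta k).
Notation evalj := (@evalj U delta k).
Implicit Types (z : U) (c h : mpoly k U) (Q M N : {poly mpoly k U}).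

Lemma evalcM z c h : evalc z (c * h) = evalc z c * evalc z h.
Proof. by rewrite evalc.unlock mevalM. Qed.

Lemma evalcD z c h : evalc z (c + h) = evalc z c + evalc z h.
Proof. by rewrite evalc.unlock mevalD. Qed.

Lemma evalc1 z : evalc z 1 = 1.
Proof. by rewrite evalc.unlock meval1. Qed.

Lemma evaljD z Q M : evalj z (Q + M) = evalj z Q + evalj z M.
Proof. by rewrite evalj.unlock rmorphD hornerD. Qed.

Lemma evaljN z Q : evalj z (- Q) = - evalj z Q.
Proof. by rewrite evalj.unlock rmorphN hornerN. Qed.

Lemma evaljM z Q M : evalj z (Q * M) = evalj z Q * evalj z M.
Proof. by rewrite evalj.unlock rmorphM hornerM. Qed.

Lemma evaljC z c : evalj z c%:P = evalc z c.
Proof. by rewrite evalc.unlock evalj.unlock map_polyC hornerC. Qed.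

Lemma evaljX z : evalj z 'X = iter k delta z.
Proof. by rewrite evalj.unlock map_polyX hornerX. Qed.

Lemma evalj_muni z (P : mpoly k.+1 U) : evalj z (muni P) = deval delta P z.
Proof. by rewrite evalj.unlock /deval meval_muni. Qed.

Lemma evalj_unmuni z Q : deval delta (unmuni Q) z = evalj z Q.
Proof. by rewrite -evalj_muni unmuniK. Qed.

Lemma overE n (c : mpoly n U) :
  mpoly_over F c <-> c \in @mpolyOver_pred n U (mem_of hF).
Proof. exact: mpoly_overP. Qed.

Lemma over_jet0 c : c \in over -> evalc f c = 0 -> c = 0.
Proof. by rewrite evalc.unlock => /overE Fc; apply: ind. Qed.

Lemma size_evalj Q : Q \is a polyOver over ->
  size (map_poly (meval (jetk f)) Q) = size Q.
Proof.
move=> /polyOverP FQ; have [->|Q0] := eqVneq Q 0; first by rewrite raddf0 !size_poly0.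
apply: size_map_poly_id0; apply: contra_neq Q0 => lc0.
have {}lc0 : lead_coef Q = 0.
  by apply: over_jet0; rewrite ?evalc.unlock //; apply: FQ.
by apply/eqP; rewrite -lead_coef_eq0 lc0.
Qed.

Lemma der_meval c : c \in over ->
  exists2 N, N \is a polyOver over &
    forall z, delta (evalc z c) = evalj z N.
Proof.
move/overE => Fc; pose P c := c \in over /\ exists2 N, N \is a polyOver over &
  forall z, delta (evalc z c) = evalj z N.
suff [] : P c by [].
apply: (mpoly_ring_ind (S := F)) Fc => {c} [|||i|p q|p q].
- split; first exact: rpred0.
  exists 0; first exact: rpred0.
  by move=> z; rewrite evalc.unlock meval0 der0 // evalj.unlock raddf0 horner0.
- split; first exact: rpred1.
  exists 0; first exact: rpred0.
  by move=> z; rewrite evalc.unlock meval1 der1 // evalj.unlock raddf0 horner0.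
- move=> c Fc; split; first by apply/overE => m; rewrite mcoeffC; case: eqP => _;
    rewrite ?mulr1 ?mulr0 //; apply: subfield0.
  exists (mpolyC k (delta c))%:P; last by move=> z; rewrite evaljC evalc.unlock !mevalC.
  rewrite polyOverC; apply/overE => m; rewrite mcoeffC; case: eqP => _;
    rewrite ?mulr1 ?mulr0 //; by [apply: dF|apply: subfield0].
- split; first exact: mpolyOverX.
  have [ik|ki] := ltnP i.+1 k.
    exists (mpolyX U (mnm1 (Ordinal ik)))%:P.
      by rewrite polyOverC; apply: mpolyOverX.
    by move=> z; rewrite evaljC evalc.unlock !mevalXU.
  exists 'X; first exact: polyOverX.
  have ik : i.+1 = k by apply/eqP; rewrite eqn_leq (ltn_ord i) ki.
  by move=> z; rewrite evaljX evalc.unlock mevalXU /jet -iterS ik.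
- move=> [Fp [Np FNp Dp]] [Fq [Nq FNq Dq]]; split; first exact: rpredD.
  exists (Np + Nq); first exact: rpredD.
  by move=> z; rewrite evalcD derD // Dp Dq evaljD.
- move=> [Fp [Np FNp Dp]] [Fq [Nq FNq Dq]]; split; first exact: rpredM.
  exists (Np * q%:P + p%:P * Nq).
    by apply: rpredD; apply: rpredM; rewrite ?polyOverC.
  by move=> z; rewrite evalcM derM // Dp Dq evaljD !evaljM !evaljC.
Qed.

(** The chain rule, with the next derivative of [z] singled out. *)
Lemma der_evalj Q : Q \is a polyOver over ->
  exists2 N, N \is a polyOver over &
    forall z, delta (evalj z Q) = evalj z N + evalj z Q^`() * iter k.+1 delta z.
Proof.
elim/poly_ind: Q => [_|Q c IH FQc].
  exists 0; first exact: rpred0.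
  by move=> z; rewrite linear0 evalj.unlock raddf0 horner0 mul0r addr0 der0.
have FQ : Q \is a polyOver over.
  apply/polyOverP=> i; have /polyOverP/(_ i.+1) := FQc.
  by rewrite coefD coefMX coefC addr0.
have Fc : c \in over.
  by have /polyOverP/(_ 0%N) := FQc; rewrite coefD coefMX coefC add0r.
have [N FN DN] := IH FQ; have [M FM DM] := der_meval Fc.
exists (N * 'X + M).
  by apply: rpredD => //; apply: rpredM => //; apply: polyOverX.
move=> z; rewrite derivD derivM derivX derivC addr0 mulr1.
rewrite !evaljD !evaljM evaljX evaljC derD // derM // DN DM iterS; ring.
Qed.

Variable G : {poly mpoly k U}.
Hypotheses (FG : G \is a polyOver over) (G0 : G != 0) (Gf : evalj f G = 0).
Hypothesis minG : forall Q, Q \is a polyOver over -> Q != 0 -> evalj f Q = 0 ->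
  (size G <= size Q)%N.

Lemma jet_div Q H : Q \is a polyOver over -> H \is a polyOver over -> H != 0 ->
  exists c A Rm, [/\ c \in over, c != 0, A \is a polyOver over,
    Rm \is a polyOver over & c%:P * Q = A * H + Rm /\ (size Rm < size H)%N].
Proof.
move=> FQ FH H0; have psi1 : meval (jetk f) 1 = 1 by rewrite meval1.
have psiB : {in over &, forall x y, meval (jetk f) (x - y) =
  meval (jetk f) x - meval (jetk f) y} by move=> x y _ _; rewrite mevalB.
have psiM : {in over &, forall x y, meval (jetk f) (x * y) =
  meval (jetk f) x * meval (jetk f) y} by move=> x y _ _; rewrite mevalM.
have := pseudo_div psi1 psiB psiM FQ FH.
rewrite -size_poly_gt0 size_evalj // size_poly_gt0 => /(_ H0).
move=> [c [A [Rm [Fc c0 FA FR [D zR]]]]].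
exists c, A, Rm; rewrite !size_evalj // in zR *; split=> //.
by apply: contra_neq c0 => ->; rewrite meval0.
Qed.

(** Here [G] is a minimal equation of [delta^k f] over the lower derivatives, and
    the remainder of [Q] modulo [G] vanishes by minimality. *)
Lemma evalj_zero Q : Q \is a polyOver over -> evalj f Q = 0 ->
  exists c, [/\ c \in over, c != 0 &
    forall z, evalj z G = 0 -> evalc z c * evalj z Q = 0].
Proof.
move=> FQ Qf; have [c [A [Rm [Fc c0 FA FR [D zR]]]]] := jet_div FQ FG G0.
have DR z : evalc z c * evalj z Q = evalj z A * evalj z G + evalj z Rm.
  by rewrite -evaljC -!evaljM D evaljD evaljM.
have R0 : Rm = 0.
  apply/eqP; apply: contraTT zR => R0; rewrite -leqNgt minG //.
  by have := DR f; rewrite Qf Gf !mulr0 add0r.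
exists c; split=> // z Gz; rewrite DR Gz R0 mulr0 add0r.
by rewrite evalj.unlock raddf0 horner0.
Qed.

(** A differential polynomial that does not vanish at [f] has an inverse modulo
    [G], up to a denominator of smaller order; this is Euclid's algorithm,
    with [G] irreducible by minimality. *)
Lemma evalj_unit Q : Q \is a polyOver over -> evalj f Q != 0 ->
  exists M h, [/\ M \is a polyOver over, h \in over, h != 0 &
    forall z, evalj z G = 0 -> evalj z Q * evalj z M = evalc z h].
Proof.
have [m] := ubnP (size Q); elim: m Q => // m IH Q; rewrite ltnS => zQ FQ Qf.
have Q0 : Q != 0 by apply: contra_neq Qf => ->; rewrite evalj.unlock raddf0 horner0.
have [big|small] := leqP (size G) (size Q).
  have [c [A [Rm [Fc c0 FA FR [D zR]]]]] := jet_div FQ FG G0.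
  have DR z : evalj z G = 0 -> evalc z c * evalj z Q = evalj z Rm.
    by move=> Gz; rewrite -evaljC -evaljM D evaljD evaljM Gz mulr0 add0r.
  have [||M [h [FM Fh h0 Dh]]] := IH Rm _ FR.
  - by apply: leq_trans zR (leq_trans big zQ).
  - by rewrite -DR // mulf_neq0 //; apply: contra_neq c0 => /over_jet0 ->.
  exists (c%:P * M), h; split=> // [|z Gz]; first by rewrite rpredM ?polyOverC.
  by rewrite evaljM evaljC mulrA [evalj z Q * _]mulrC DR // Dh.
have [zQ1|zQ1] := leqP (size Q) 1.
  have DQ := size1_polyC zQ1.
  exists 1, Q`_0; split; first exact: rpred1.
  - by apply/polyOverP.
  - by apply: contra_neq Q0; rewrite {2}DQ => ->.
  by move=> z _; rewrite {1}DQ evaljC -polyC1 evaljC evalc1 mulr1.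
(* [Q] is shorter than [G]: divide [G] by [Q]. The remainder cannot vanish at
   [f], for otherwise [G] would split into factors of smaller size. *)
have [c [A [Rm [Fc c0 FA FR [D zR]]]]] := jet_div FG FQ Q0.
have DR z : evalj z G = 0 -> evalj z Rm = - (evalj z A * evalj z Q).
  move=> Gz; apply/eqP; rewrite -addr_eq0 addrC -evaljM -evaljD -D evaljM.
  by rewrite Gz mulr0.
have [Rf|Rf] := eqVneq (evalj f Rm) 0; last first.
  have [|M [h [FM Fh h0 Dh]]] := IH Rm _ FR Rf; first exact: leq_trans zR zQ.
  exists (- A * M), h; split=> // [|z Gz]; first by rewrite rpredM ?rpredN.
  by rewrite -Dh // DR // evaljM evaljN; ring.
have R0 : Rm = 0.
  apply/eqP; apply: contraTT zR => R0; rewrite -leqNgt.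
  exact: leq_trans (ltnW small) (minG FR R0 Rf).
have A0 : A != 0.
  apply: contraTneq isT => A0; move/eqP: D.
  by rewrite A0 R0 mul0r addr0 mulf_eq0 polyC_eq0 (negbTE c0) (negbTE G0).
have Af : evalj f A = 0.
  have /eqP := DR f Gf; rewrite Rf eq_sym oppr_eq0 mulf_eq0 (negbTE Qf) orbF.
  by move/eqP.
have := minG FA A0 Af; rewrite leqNgt.
have := congr1 (size : {poly mpoly k U} -> nat) D.
rewrite R0 addr0 size_Cmul // size_mul // => ->.
by rewrite -subn1 -addnBA ?(ltnW zQ1) // -{1}[size A]addn0 ltn_add2l subn_gt0 zQ1.
Qed.


(** Functions of [z] which on a generic part of the zeros of [G] are quotients
    of polynomials in [z, ..., delta^k z] by denominators of order below [k].
    All derivatives of [z] turn out to be of this kind. *)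
Definition regular (phi : U -> U) : Prop :=
  exists N h, [/\ N \is a polyOver over, h \in over, h != 0 &
    forall z, evalj z G = 0 -> evalc z h != 0 ->
      phi z * evalc z h = evalj z N].

Lemma regular_evalj N : N \is a polyOver over -> regular (evalj^~ N).
Proof.
move=> FN; exists N, 1; rewrite oner_eq0; split=> // [|z _ _].
  exact: rpred1.
by rewrite evalc1 mulr1.
Qed.

Lemma regular_meval c : c \in over -> regular (fun z => evalc z c).
Proof.
move=> Fc; have [|N [h [FN Fh h0 Dh]]] := @regular_evalj c%:P.
  by rewrite polyOverC.
exists N, h; split=> // z Gz hz; rewrite -Dh // evaljC //.
Qed.

Lemma regularD phi1 phi2 : regular phi1 -> regular phi2 ->
  regular (fun z => phi1 z + phi2 z).
Proof.
move=> [N [h [FN Fh h0 Dh]]] [N' [h' [FN' Fh' h'0 Dh']]].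
exists (N * h'%:P + N' * h%:P), (h * h').
split; rewrite ?mulf_neq0 //; try exact: rpredM.
  by apply: rpredD; apply: rpredM; rewrite ?polyOverC.
move=> z Gz; rewrite evalcM mulf_eq0 negb_or => /andP[hz h'z].
have E (a b c d : U) : (a + b) * (c * d) = a * c * d + b * d * c by ring.
by rewrite E (Dh z Gz hz) (Dh' z Gz h'z) evaljD; congr (_ + _);
  rewrite evaljM evaljC.
Qed.

Lemma regularM phi1 phi2 : regular phi1 -> regular phi2 ->
  regular (fun z => phi1 z * phi2 z).
Proof.
move=> [N [h [FN Fh h0 Dh]]] [N' [h' [FN' Fh' h'0 Dh']]].
exists (N * N'), (h * h').
split; rewrite ?mulf_neq0 //; try exact: rpredM.
move=> z Gz; rewrite evalcM mulf_eq0 negb_or => /andP[hz h'z].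
by rewrite mulrACA (Dh z Gz hz) (Dh' z Gz h'z) evaljM.
Qed.

Lemma regular_denom phi psi h0 : h0 \in over -> h0 != 0 -> regular psi ->
    (forall z, evalj z G = 0 -> evalc z h0 != 0 ->
       phi z * evalc z h0 = psi z) ->
  regular phi.
Proof.
move=> Fh0 h00 [N [h [FN Fh hn0 Dh]]] Dphi.
exists N, (h0 * h); split; rewrite ?mulf_neq0 //; first exact: rpredM.
move=> z Gz; rewrite evalcM mulf_eq0 negb_or => /andP[hz h'z].
by rewrite mulrA (Dphi z Gz hz) (Dh z Gz h'z).
Qed.

Lemma regularN phi : regular phi -> regular (fun z => - phi z).
Proof.
move=> [N [h [FN Fh h0 Dh]]]; exists (- N), h; split; rewrite ?rpredN //.
by move=> z Gz hz; rewrite mulNr Dh // evaljN.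
Qed.

(** The separant of [G] is invertible at generic zeros of [G], so that
    differentiating [G z = 0] gives the next derivative of [z]. *)
Lemma regular_next : regular (iter k.+1 delta).
Proof.
have zG : (1 < size G)%N.
  rewrite ltnNge; apply: contraNN G0 => zG; move: Gf.
  rewrite (size1_polyC zG) evaljC => Gf0; rewrite polyC_eq0; apply/eqP.
  by apply: over_jet0 Gf0; apply/polyOverP.
have FG' : G^`() \is a polyOver over.
  by apply/polyOverP=> i; rewrite coef_deriv rpredMn //; apply/polyOverP.
have G'f : evalj f G^`() != 0.
  apply: contraTneq isT => /(minG FG' (deriv_neq0 (mpoly_pchar0 k char0) zG)).
  rewrite leqNgt (leq_ltn_trans (size_poly _ _)) //.
  by case: (size G) zG.
have [M [h [FM Fh h0 Dh]]] := evalj_unit FG' G'f.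
have [N FN DN] := der_evalj FG.
apply: (regular_denom Fh h0 (psi := fun z => - (evalj z N * evalj z M))).
  by apply/regularN/regularM; apply: regular_evalj.
move=> z Gz _; rewrite -Dh //; have := DN z; rewrite Gz der0 // => /eqP.
rewrite eq_sym addr_eq0 => /eqP ->; ring.
Qed.

Lemma regular_der phi : regular phi -> regular (fun z => delta (phi z)).
Proof.
move=> rphi; have [N [h [FN Fh h0 Dh]]] := rphi.
have [N1 FN1 DN1] := der_evalj FN; have [N2 FN2 DN2] := der_meval Fh.
have FN' : N^`() \is a polyOver over.
  by apply/polyOverP=> i; rewrite coef_deriv rpredMn //; apply/polyOverP.
apply: (regular_denom Fh h0 (psi := fun z =>
  (evalj z N1 + evalj z N^`() * iter k.+1 delta z) - phi z * evalj z N2)).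
  apply: regularD.
    apply: regularD; first exact: regular_evalj.
    by apply: regularM regular_next; apply: regular_evalj.
  by apply/regularN/regularM => //; apply: regular_evalj.
move=> z Gz hz; rewrite -DN1 -DN2 -Dh // derM //; ring.
Qed.

Lemma regular_iter i : regular (iter i delta).
Proof.
elim: i => [|i]; last exact: regular_der.
have [k0|k0] := posnP k.
  have -> : iter 0 delta = evalj^~ 'X.
    by apply/funext=> z; rewrite evaljX k0.
  exact/regular_evalj/polyOverX.
have -> : iter 0 delta = (fun z => evalc z (mpolyX U (mnm1 (Ordinal k0)))).
  by apply/funext=> z; rewrite evalc.unlock mevalXU.
by apply: regular_meval; apply: mpolyOverX.
Qed.

Lemma regular_deval n (P : mpoly n U) : mpoly_over F P -> regular (deval delta P).
Proof.
apply: (mpoly_ring_ind (S := F) (P := fun P => regular (deval delta P)))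
  => [|||i|p q Hp Hq|p q Hp Hq].
- have -> : deval delta (0 : mpoly n U) = evalj^~ 0.
    by apply/funext=> z; rewrite /deval meval0 evalj.unlock raddf0 horner0.
  exact/regular_evalj/rpred0.
- have -> : deval delta (1 : mpoly n U) = evalj^~ 1%:P.
    by apply/funext=> z; rewrite /deval meval1 evaljC evalc1.
  by apply: regular_evalj; rewrite polyOverC; apply: rpred1.
- move=> c Fc; have -> : deval delta (mpolyC n c) = evalj^~ (mpolyC k c)%:P.
    by apply/funext=> z; rewrite /deval mevalC evaljC evalc.unlock mevalC.
  apply: regular_evalj; rewrite polyOverC -[_ \in _]/(_ \in mpolyOver k (mem_of hF)).
  by rewrite mpolyOverC; apply/mem_ofP.
- have -> : deval delta (mpolyX U (mnm1 i)) = iter i delta.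
    by apply/funext=> z; rewrite /deval mevalXU.
  exact: regular_iter.
- have -> : deval delta (p + q) = (fun z => deval delta p z + deval delta q z).
    by apply/funext=> z; rewrite /deval mevalD.
  exact: regularD.
- have -> : deval delta (p * q) = (fun z => deval delta p z * deval delta q z).
    by apply/funext=> z; rewrite /deval mevalM.
  exact: regularM.
Qed.

(** [phi] is a fraction at [z]; a numerator vanishing at [f] vanishes at generic
    zeros of [G], and any other is invertible there. *)
Lemma regular_zero phi : regular phi ->
  exists h, [/\ h \in over, h != 0 &
    forall z, evalj z G = 0 -> evalc z h != 0 ->
      (phi z == 0) = (phi f == 0)].
Proof.
move=> [N [h [FN Fh h0 Dh]]].
have hf : evalc f h != 0 by apply: contra_neq h0 => /over_jet0 ->.
have [Nf|Nf] := eqVneq (evalj f N) 0.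
  have [c [Fc c0 Dc]] := evalj_zero FN Nf; exists (h * c).
  rewrite rpredM ?mulf_neq0 //; split=> // z Gz.
  rewrite evalcM mulf_eq0 negb_or => /andP[hz cz].
  have := Dh f Gf hf; rewrite Nf => /eqP; rewrite mulf_eq0 (negbTE hf) orbF => ->.
  have /eqP := Dc z Gz; rewrite mulf_eq0 (negbTE cz) -Dh // mulf_eq0.
  by rewrite (negbTE hz) orbF.
have [M [c [FM Fc c0 Dc]]] := evalj_unit FN Nf; exists (h * c).
rewrite rpredM ?mulf_neq0 //; split=> // z Gz.
rewrite evalcM mulf_eq0 negb_or => /andP[hz cz].
have -> : (phi f == 0) = false.
  by apply: contraNF Nf => /eqP phi0; rewrite -(Dh f Gf hf) phi0 mul0r.
by apply: contraNF cz => /eqP phi0; rewrite -(Dc z Gz) -(Dh z Gz hz) phi0 !mul0r.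
Qed.

Lemma generic_zeros n (Ps : seq (mpoly n U)) :
    (forall P, P \in Ps -> mpoly_over F P) ->
  exists h, [/\ h \in over, h != 0 &
    forall z, evalj z G = 0 -> evalc z h != 0 ->
      forall P, P \in Ps -> (deval delta P z == 0) = (deval delta P f == 0)].
Proof.
elim: Ps => [|P Ps IH] FPs.
  by exists 1; rewrite oner_eq0; split=> //; apply: rpred1.
have [|h [Fh h0 Dh]] := IH; first by move=> Q QPs; apply: FPs; rewrite in_cons QPs orbT.
have [|c [Fc c0 Dc]] := @regular_zero (deval delta P).
  by apply/regular_deval/FPs; rewrite in_cons eqxx.
exists (h * c); rewrite rpredM ?mulf_neq0 //; split=> // z Gz.
rewrite evalcM mulf_eq0 negb_or => /andP[hz cz] Q.
by rewrite in_cons => /orP[/eqP->|/Dh]; [apply: Dc|apply].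
Qed.

End GenericZeros.

Lemma mderiv_mwiden (R : comNzRingType) k (c : mpoly k R) :
  mderiv ord_max (mwiden c) = 0.
Proof.
apply: (mpoly_ring_ind (S := setT) (P := fun c => mderiv ord_max (mwiden c) = 0))
  => [|||i|p q Hp Hq|p q Hp Hq|//].
- by rewrite mwiden0 mderiv0.
- by rewrite mwiden1 -mpolyC1 mderivC.
- by move=> a _; rewrite mwidenC mderivC.
- by rewrite mwidenX mnmwiden1 mderivX mnm1E -val_eqE /= ltn_eqF // scale0r.
- by rewrite mwidenD mderivD Hp Hq addr0.
- by rewrite mwidenM mderivM Hp Hq mul0r mulr0 addr0.
Qed.

Lemma mderiv_unmuni (R : comNzRingType) k (Q : {poly mpoly k R}) :
  mderiv ord_max (unmuni Q) = unmuni Q^`().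
Proof.
elim/poly_ind: Q => [|Q c IH].
  by rewrite linear0 -polyC0 unmuniC mwiden0 mderiv0.
rewrite derivD derivM derivX derivC addr0 mulr1.
rewrite !unmuniD !unmuniM unmuniX unmuniC mderivD mderivM mderiv_mwiden addr0.
rewrite IH mderivX mnm1E eqxx scale1r.
rewrite (_ : mnm_sub _ _ = mnm0) ?mpolyX0 ?mulr1 ?unmuniD ?unmuniM ?unmuniX //.
by apply/mnmP=> i; rewrite mnmBE mnm0E subnn.
Qed.

(** Off a hypersurface of order below [k], the zeros of the minimal equation [G]
    of [f] satisfy the same conditions as [f]. Blum's axiom, applied to [G],
    finds zeros that avoid both this hypersurface and [H]. *)
Lemma dense_specializations (U : fieldType) (delta : U -> U) (F X : set U)
    (k n : nat) (f : U) (P : mpoly n U) (H : mpoly k U) :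
    DCF0 delta -> dsubfield delta F -> diff_equation delta F X -> X f ->
    alg_indep F (jet delta k f) -> ~ alg_indep F (jet delta k.+1 f) ->
    mpoly_over F P -> H != 0 ->
  exists z, [/\ X z, deval delta H z != 0 &
    (deval delta P z == 0) = (deval delta P f == 0)].
Proof.
move=> [char0 hd blum] [hF dF] [N [eqs [neqs [FE ->]]]] [ef nf] ind dep FP H0.
pose good Q := [/\ Q \is a polyOver (@mpolyOver_pred k U (mem_of hF)), Q != 0
  & @evalj U delta k f Q = 0].
have [Q0 gQ0] : exists Q, good Q.
  apply: contra_notP dep => nogood Q /(mpoly_overP hF) FQ Qf.
  apply/eqP; apply: contra_notT nogood => Q0; exists (muni Q).
  split; rewrite ?evalj_muni ?muni_over //.
  apply: contraNneq Q0 => mQ0; have := muniK Q.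
  by rewrite mQ0 -polyC0 unmuniC mwiden0 => <-.
have exm : exists m, `[< exists2 Q, good Q & size Q = m >].
  by exists (size Q0); apply/asboolP; exists Q0.
case: (ex_minnP exm) => m /asboolP[G [FG G0 Gf] zG] minG.
have {}minG Q : Q \is a polyOver (@mpolyOver_pred k U (mem_of hF)) -> Q != 0 ->
    @evalj U delta k f Q = 0 -> (size G <= size Q)%N.
  by move=> FQ Qn0 Qf; rewrite zG; apply/minG/asboolP; exists Q.
have [h [Fh h0 Dh]] := generic_zeros hd char0 dF ind FG G0 Gf minG FE.
have [|c [Fc c0 Dc]] := generic_zeros hd char0 dF ind FG G0 Gf minG (Ps := [:: P]).
  by move=> Q; rewrite inE => /eqP->.
have zG1 : (1 < size G)%N.
  rewrite ltnNge; apply: contraNN G0 => zG1; move: Gf.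
  rewrite (size1_polyC zG1) evaljC => Gf0; rewrite polyC_eq0; apply/eqP.
  by apply: (over_jet0 ind _ Gf0); apply/polyOverP.
have [||z [Gz hHz]] := blum k (unmuni G) (h * c * H).
- rewrite mderiv_unmuni; apply: contraNneq (deriv_neq0 (mpoly_pchar0 k char0) zG1) => G'0.
  by rewrite -[_^`()]unmuniK G'0 muni0.
- by rewrite !mulf_neq0.
move: hHz; rewrite {1}/deval !mevalM !mulf_eq0 !negb_or.
move=> /andP[/andP[hz cz] Hz].
rewrite evalj_unmuni in Gz.
have {}hz : @evalc U delta k z h != 0 by rewrite evalc.unlock.
have {}cz : @evalc U delta k z c != 0 by rewrite evalc.unlock.
exists z; split=> //; last by rewrite (Dc z Gz cz) ?inE.
split=> [Q Qe|Q Qn].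
  by apply/eqP; rewrite (Dh z Gz hz) ?ef // mem_cat Qe.
by rewrite (Dh z Gz hz) ?nf // mem_cat Qn orbT.
Qed.

(** * Differential algebraic closure *)

Section DifferentialClosure.
Variables (U : fieldType) (delta : U -> U).
Hypotheses (hd : derivation delta) (char0 : [pchar U] =i pred0).
Implicit Types E F K L : set U.

Lemma dgen_dsubfield (S : set U) : dsubfield delta (dgen delta S).
Proof.
split; last by move=> x Sx A hA; apply: (proj2 (proj1 hA)); apply: Sx.
split=> [A [[[A1 _ _] _] _] //|x y Sx Sy A hA|x y Sx Sy A hA].
  by apply: subfieldB (proj1 (proj1 hA)) _ _; [apply: Sx|apply: Sy].
by apply: subfield_div (proj1 (proj1 hA)) _ _; [apply: Sx|apply: Sy].
Qed.

Lemma sub_dgen (S : set U) : S `<=` dgen delta S.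
Proof. by move=> x Sx A [_]; apply. Qed.

Lemma dgen_min (S F : set U) : dsubfield delta F -> S `<=` F -> dgen delta S `<=` F.
Proof. by move=> hF SF x; apply. Qed.

Lemma derV x : delta x^-1 = - (delta x * (x ^+ 2)^-1).
Proof.
have [->|x0] := eqVneq x 0; first by rewrite invr0 (der0 hd) mul0r oppr0.
have : delta (x * x^-1) = 0 by rewrite divff // (der1 hd).
rewrite (derM hd) => /eqP; rewrite addrC addr_eq0 => /eqP xdV.
by apply: (mulfI x0); rewrite xdV; field.
Qed.

Lemma fgen_der (S L : set U) : subfield L -> fgen S `<=` L ->
  (forall x, S x -> L (delta x)) -> forall x, fgen S x -> L (delta x).
Proof.
move=> hL SL SdL; pose A x := fgen S x /\ L (delta x).
suff hA : subfield A.
  move=> x Sx; have [] // : A x.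
  by apply: fgen_min Sx => // y Sy; split; [apply: sub_fgen|apply: SdL].
have hS := @fgen_subfield U S.
split=> [|x y [Sx Lx] [Sy Ly]|x y [Sx Lx] [Sy Ly]].
- split; first exact: (subfield1 hS).
  by rewrite (der1 hd); apply: (subfield0 hL).
- split; first exact: (subfieldB hS Sx Sy).
  by rewrite (derB hd); apply: (subfieldB hL Lx Ly).
have [Lx' Ly'] := (SL _ Sx, SL _ Sy).
split; first exact: (subfield_div hS Sx Sy).
rewrite (derM hd) derV.
apply: (subfieldD hL (subfield_div hL Lx Ly')).
apply: (subfieldM hL Lx'); apply: (subfieldN hL).
apply: (subfield_div hL Ly); rewrite expr2; exact: (subfieldM hL Ly' Ly').
Qed.

(** Differentiating the minimal equation [p(a) = 0] expresses [delta a] by [a]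
    and the derivatives of the coefficients of [p]. *)
Lemma acl_der F : subfield F -> (forall x, F x -> acl F (delta x)) ->
  forall x, acl F x -> acl F (delta x).
Proof.
move=> hF dF a Fa; have hL := acl_subfield hF.
pose P m := `[< exists p : {poly U}, [/\ p != 0, forall i, F p`_i, root p a & size p = m] >].
have exP : exists m, P m.
  by case: Fa => p [p0 Fp pa]; exists (size p); apply/asboolP; exists p.
case: (ex_minnP exP) => m /asboolP[p [p0 Fp pa zp]] minp.
have FL := sub_acl hF; move: (acl F) hL FL (Fa : acl F a) dF => L hL FL La dF.
have Lp i : L p`_i by apply: FL.
have horner_L (q : {poly U}) : (forall i, L q`_i) -> L q.[a].
  move=> Lq; rewrite horner_coef; apply: (big_ind L).
  - exact: (subfield0 hL).
  - by move=> x y; apply: (subfieldD hL).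
  move=> i _; apply: (subfieldM hL) => //.
  by apply/(mem_ofP hL)/rpredX/mem_ofP.
have der_horner (q : {poly U}) : (forall i, F q`_i) ->
    exists2 c, L c & delta q.[a] = c + q^`().[a] * delta a.
  elim/poly_ind: q => [_|q c IH Fqc].
    exists 0; first exact: (subfield0 hL).
    by rewrite linear0 !horner0 (der0 hd) mul0r addr0.
  have Fq i : F q`_i by have := Fqc i.+1; rewrite coefD coefMX coefC addr0.
  have Fc : F c by have := Fqc 0%N; rewrite coefD coefMX coefC add0r.
  have [b Lb Db] := IH Fq; exists (b * a + delta c).
    apply: (subfieldD hL); last exact: dF.
    exact: (subfieldM hL).
  rewrite derivD derivM derivX derivC addr0 mulr1 !hornerE.
  by rewrite (derD hd) (derM hd) Db; ring.
have zp1 : (1 < size p)%N.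
  rewrite ltnNge; apply: contraTN pa => zp1; rewrite (size1_polyC zp1) rootC.
  by apply: contra p0 => /eqP p0; rewrite (size1_polyC zp1) p0.
have p'0 : p^`() != 0 := deriv_neq0 char0 zp1.
have p'a : p^`().[a] != 0.
  apply: contraTneq isT => p'a; have := minp (size p^`()).
  rewrite leqNgt -zp (leq_ltn_trans (size_poly _ _)); last first.
    by case: (size p) zp1.
  move/(_ _) => h; suff /h : P (size p^`()) by [].
  apply/asboolP; exists p^`(); split=> //; last exact/rootP.
  move=> i; rewrite coef_deriv -mulr_natl; apply: (subfieldM hF) => //.
  by apply/(mem_ofP hF)/rpred_nat.
have [c Lc] := der_horner p Fp.
rewrite (rootP pa) (der0 hd) => /esym/eqP; rewrite addrC addr_eq0 => /eqP Da.
have -> : delta a = - c / p^`().[a] by rewrite -Da mulrC mulKf.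
apply: (subfield_div hL); first exact: (subfieldN hL).
apply: horner_L => i; rewrite coef_deriv -mulr_natl; apply: (subfieldM hL) => //.
by apply/(mem_ofP hL)/rpred_nat.
Qed.

Lemma alg_indep0 F (a : 'I_0 -> U) : subfield F -> alg_indep F a.
Proof.
move=> hF; apply/(alg_indep_seq _ hF).
by rewrite (_ : enum 'I_0 = [::]) //; apply/size0nil; rewrite size_enum_ord.
Qed.

Lemma jet_rank F n y : subfield F -> ~ alg_indep F (jet delta n y) ->
  exists k, [/\ (k < n)%N, alg_indep F (jet delta k y)
    & ~ alg_indep F (jet delta k.+1 y)].
Proof.
move=> hF; elim: n => [|n IH] dep; first by case: dep; apply: alg_indep0.
have [indn|/IH[k [kn indk depk]]] := pselect (alg_indep F (jet delta n y)).
  by exists n.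
by exists k; split=> //; apply: ltnW.
Qed.

(** The derivation maps the field generated by the lower derivatives into its
    algebraic closure, which is therefore a differential field. *)
Lemma dgen_sub_acl_jet K k y : dsubfield delta K ->
    alg_indep K (jet delta k y) -> ~ alg_indep K (jet delta k.+1 y) ->
  dgen delta (K `|` [set y]) `<=` acl (fgen (K `|` range (jet delta k y))).
Proof.
move=> [hK dK] indk depk; set J := fgen _; have hJ : subfield J := @fgen_subfield U _.
have Jk : acl J (iter k delta y).
  apply: contrapT => nJ; apply: depk.
  by apply/(alg_indep_last _ hK); split.
have J0 : acl J y.
  have [k0|k0] := posnP k; first by move: Jk; rewrite k0.
  by apply: (sub_acl hJ); apply: sub_fgen; right; exists (Ordinal k0).
apply: dgen_min.
  split; first exact: acl_subfield.
  move=> x; apply: acl_der => // {x}.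
  apply: fgen_der; [exact: acl_subfield|exact: sub_acl|].
  move=> x [Kx|[i _ <-]].
    by apply: (sub_acl hJ); apply: sub_fgen; left; apply: dK.
  have [ik|ki] := ltnP i.+1 k.
    by apply: (sub_acl hJ); apply: sub_fgen; right; exists (Ordinal ik).
  have ik : i.+1 = k by apply/eqP; rewrite eqn_leq (ltn_ord i) ki.
  by rewrite /jet -iterS ik.
move=> x [Kx|->] //.
by apply: (sub_acl hJ); apply: sub_fgen; left.
Qed.

End DifferentialClosure.

(** * Solutions of strongly minimal equations *)

Section StronglyMinimal.
Variables (U : fieldType) (delta : U -> U) (hU : DCF0 delta).
Implicit Types (K F X : set U).

Let hd : derivation delta.
Proof. by case: hU. Qed.

Let char0 : [pchar U] =i pred0.
Proof. by case: hU. Qed.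

Lemma mpoly_term (S : set U) n (P : mpoly n U) : S 0 -> S 1 -> mpoly_over S P ->
  exists2 t : dterm U, dterm_params t `<=` S &
    forall y, dterm_eval delta (fun i => if i == 0%N then y else 0) t =
      deval delta P y.
Proof.
move=> S0 S1; apply: (mpoly_ring_ind (S := S) (P := fun P =>
  exists2 t : dterm U, dterm_params t `<=` S &
    forall y, dterm_eval delta (fun i => if i == 0%N then y else 0) t =
      deval delta P y)) => [|||i|p q /=|p q /=].
- by exists (DConst 0) => [_ ->|y] //; rewrite /deval meval0.
- by exists (DConst 1) => [_ ->|y] //; rewrite /deval meval1.
- by move=> c Sc; exists (DConst c) => [_ ->|y] //; rewrite /deval mevalC.
- exists (iter i (@DDer U) (DVar U 0)).
    by elim: (val i).
  by move=> y; rewrite /deval mevalXU; elim: (val i) => //= j ->.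
- move=> [t St Dt] [u Su Du]; exists (DAdd t u); first by move=> x [/St|/Su].
  by move=> y; rewrite /= Dt Du /deval mevalD.
- move=> [t St Dt] [u Su Du]; exists (DMul t u); first by move=> x [/St|/Su].
  by move=> y; rewrite /= Dt Du /deval mevalM.
Qed.

Lemma definable_zeros n (P : mpoly n U) :
  definable delta [set y | deval delta P y = 0].
Proof.
have [//|//|//|t _ Dt] := @mpoly_term setT n P.
exists (DEq t (DConst 0)); apply/seteqP; split=> y; rewrite /dform_sat1 /= Dt //.
Qed.

Lemma definableI (A B : set U) :
  definable delta A -> definable delta B -> definable delta (A `&` B).
Proof.
move=> [phi ->] [psi ->]; exists (DAnd phi psi).
by apply/seteqP; split=> y; rewrite /dform_sat1.
Qed.

Lemma definableC (A : set U) : definable delta A -> definable delta (~` A).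
Proof.
by move=> [phi ->]; exists (DNot phi); apply/seteqP; split=> y; rewrite /dform_sat1.
Qed.

Lemma definableT : definable delta setT.
Proof.
exists (DEq (DConst 0) (DConst 0)).
by apply/seteqP; split=> y; rewrite /dform_sat1.
Qed.

Lemma definable_all n (Ps : seq (mpoly n U)) (A : mpoly n U -> set U) :
  (forall P, definable delta (A P)) ->
  definable delta [set y | forall P, P \in Ps -> A P y].
Proof.
move=> defA; elim: Ps => [|P Ps IH].
  by rewrite (_ : [set y | _] = setT); [apply: definableT|apply/seteqP; split].
rewrite (_ : [set y | _] = A P `&` [set y | forall P, P \in Ps -> A P y]).
  exact: definableI.
apply/seteqP; split=> y /= => [h|[AP h] Q].
  by split=> [|Q QPs]; apply: h; rewrite in_cons ?eqxx ?QPs ?orbT.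
by rewrite in_cons => /orP[/eqP->|/h].
Qed.

Lemma definable_diff_equation K X : diff_equation delta K X -> definable delta X.
Proof.
move=> [N [eqs [neqs [_ ->]]]]; apply: definableI.
  by apply: definable_all => P; apply: definable_zeros.
apply: (@definable_all _ neqs (fun Q => [set y | deval delta Q y != 0])) => Q.
rewrite (_ : [set y | _] = ~` [set y | deval delta Q y = 0]).
  exact/definableC/definable_zeros.
by apply/seteqP; split=> y /= /eqP.
Qed.

Lemma diff_equation_mono K F X : K `<=` F ->
  diff_equation delta K X -> diff_equation delta F X.
Proof.
move=> KF [N [eqs [neqs [KP ->]]]]; exists N, eqs, neqs; split=> // P /KP h m.
exact/KF/h.
Qed.

(** Since [k > 0], a hypersurface of order below [k] can be enlarged by any
    finite set of points. *)
Lemma infinite_specializations F X k n f (P : mpoly n U) (H : mpoly k U) :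
    dsubfield delta F -> diff_equation delta F X -> X f -> (0 < k)%N ->
    alg_indep F (jet delta k f) -> ~ alg_indep F (jet delta k.+1 f) ->
    mpoly_over F P -> H != 0 ->
  infinite_set [set z | [/\ X z, deval delta H z != 0 &
    (deval delta P z == 0) = (deval delta P f == 0)]].
Proof.
move=> dF eqX Xf k0 ind dep FP H0 /finite_seqP[s Ds].
pose x0 : mpoly k U := mpolyX U (mnm1 (Ordinal k0)).
have lin0 (w : U) : x0 - mpolyC k w != 0.
  apply/eqP => /(congr1 (mcoeff (mnm1 (Ordinal k0)))).
  rewrite mcoeffB mcoeffX eqxx mcoeffC mcoeff0 mnm1_eq0 mulr0 subr0.
  by apply/eqP; rewrite oner_eq0.
have [|z [Xz Hz Pz]] := dense_specializations hU dF eqX Xf ind dep FP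
  (H := H * \prod_(w <- s) (x0 - mpolyC k w)).
  by rewrite mulf_neq0 // prodf_seq_neq0; apply/allP => w _; apply/implyP.
move: Hz; rewrite /deval mevalM mulf_eq0 negb_or => /andP[Hz].
rewrite rmorph_prod /= prodf_seq_neq0 => /allP zs.
have : [set` s] z by rewrite -Ds.
move=> /zs /=; rewrite mevalB mevalC /x0 mevalXU /= subrr eqxx //.
Qed.

Variables (K X : set U) (n : nat).
Hypotheses (dK : dsubfield delta K) (eqX : diff_equation delta K X).
Hypotheses (smX : strongly_minimal delta X) (ordX : has_order delta K X n).

(** A solution attaining the supremum that defines the order. *)
Lemma generic_solution : (0 < n)%N ->
  exists y, [/\ X y, alg_indep K (jet delta n y)
    & ~ alg_indep K (jet delta n.+1 y)].
Proof.
move=> n0; have hK := proj1 dK; have [ub lub] := ordX.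
suff [y Xy ind] : exists2 y, X y & alg_indep K (jet delta n y).
  exists y; split=> // ind'; suff : (n.+1 <= n)%N by rewrite ltnn.
  apply: (ub y Xy _ _ _ ind') => i.
  have [_ dd] := @dgen_dsubfield U delta (K `|` [set y]).
  by rewrite /jet; elim: (val i) => [|j IH]; [apply: sub_dgen; right|apply: dd].
apply: contrapT => none; have : (n <= n.-1)%N; last by case: (n) n0 => // t _; rewrite ltnn.
apply: lub => y Xy d a Ka inda.
have dep : ~ alg_indep K (jet delta n y) by move=> ind; apply: none; exists y.
have [k [kn indk depk]] := jet_rank hK dep.
apply: (@leq_trans k); last by rewrite -ltnS prednK.
rewrite -[k]card_ord cardE -(size_map (jet delta k y)).
apply: (alg_indep_size hK inda) => i.
have -> : [set` map (jet delta k y) (enum 'I_k)] = range (jet delta k y).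
  apply/seteqP; split=> x /= => [/mapP[j _ ->]|[j _ <-]]; first by exists j.
  by apply/mapP; exists j; rewrite ?mem_enum.
exact: (dgen_sub_acl_jet hd char0 dK indk depk (Ka i)).
Qed.

(** A relation [P] of order below [n] cuts out a definable part of [X], finite or
    cofinite by strong minimality. It is not cofinite, because a solution of
    full rank over [K] specializes to infinitely many points off [P]. Nor is it
    finite if [f] lies on it without being algebraic over [F], because [f]
    specializes to infinitely many points of [X] on [P]. *)
Lemma algebraic_or_generic F f : dsubfield delta F -> K `<=` F -> X f ->
  ~ acl F f -> alg_indep F (jet delta n f).
Proof.
move=> dF KF Xf nf; have hF := proj1 dF; apply: contrapT => dep.
have [k [kn indk depk]] := jet_rank hF dep.
have k0 : (0 < k)%N.
  rewrite lt0n; apply: contra_notN nf => /eqP k0; rewrite k0 in depk.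
  apply: contrapT => nf; apply: depk; apply/(alg_indep_last _ hF).
  split; first exact: alg_indep0.
  rewrite (_ : range _ = set0) ?setU0 ?fgen_id //.
  by apply/seteqP; split=> // x [[]].
have [P [FP Pf P0]] : exists P : mpoly n U,
    [/\ mpoly_over F P, deval delta P f = 0 & P != 0].
  apply: contra_notP dep => noP P FP Pf; apply/eqP; apply: contra_notT noP => P0.
  by exists P.
have eqXF := diff_equation_mono KF eqX.
have [_ sm] := smX.
have [||finS|finC] := sm (X `&` [set z | deval delta P z = 0]).
- exact: definableI (definable_diff_equation eqX) (definable_zeros P).
- by move=> z [].
- have inf := infinite_specializations dF eqXF Xf k0 indk depk FP (oner_neq0 _).
  apply: inf; apply: sub_finite_set finS => z [Xz _]; rewrite Pf eqxx => /eqP Pz.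
  by split.
have [y [Xy indy depy]] := generic_solution (leq_trans k0 (ltnW kn)).
(* No condition is to be preserved here, so the zero polynomial will do. *)
have E0 : mpoly_over K (0 : mpoly 0 U).
  by move=> m; rewrite mcoeff0; apply: (subfield0 (proj1 dK)).
have n0 : (0 < n)%N := leq_trans k0 (ltnW kn).
apply: (infinite_specializations dK eqX Xy n0 indy depy E0 P0).
apply: sub_finite_set finC => z [Xz /eqP Pz _].
by split=> // -[].
Qed.

(** At the first stage over which [f] is algebraic, the [n] independent
    derivatives of [f] all become algebraic at once. *)
Lemma tower_degree (m r : nat) (F : nat -> set U) f :
    F 0%N = K -> (forall i, (i <= m)%N -> dsubfield delta (F i)) ->
    (forall i, (i < m)%N -> F i `<=` F i.+1 /\ trdeg_le (F i) (F i.+1) r) ->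
    F m f -> X f -> ~ acl K f ->
  (n <= r)%N.
Proof.
move=> F0 dF stepF Fmf Xf nf.
have KF i : (i <= m)%N -> K `<=` F i.
  elim: i => [_|i IH im]; first by rewrite F0.
  by apply: subset_trans (IH (ltnW im)) _; case: (stepF i im).
have [i [im nFi Fi1]] : exists i, [/\ (i < m)%N, ~ acl (F i) f & acl (F i.+1) f].
  apply: contrapT => none.
  suff : forall i, (i <= m)%N -> ~ acl (F i) f.
    by move=> /(_ m (leqnn m)); apply; apply: sub_acl Fmf; case: (dF m (leqnn m)).
  elim=> [|i IH] im; first by rewrite F0.
  by move=> Ff; apply: none; exists i; split=> //; apply/IH/ltnW.
have [hF _] := dF i (ltnW im); have [hF1 dF1] := dF _ im.
have [_ tr] := stepF i im.
have indf := algebraic_or_generic (dF i (ltnW im)) (KF i (ltnW im)) Xf nFi.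
apply: (trdeg_le_acl hF tr indf) => j; rewrite /jet.
elim: (val j) => [|t IH] //=; apply: acl_der => // x Fx.
by apply: (sub_acl hF1); apply: dF1.
Qed.

Lemma subset_fgen1 F a : F `<=` fgen (F `|` [set a]).
Proof. by move=> x Fx; apply: sub_fgen; left. Qed.

Lemma trdeg_le_fgen1 F a : subfield F -> trdeg_le F (fgen (F `|` [set a])) 1.
Proof.
move=> hF d b Fb indb; apply: (alg_indep_size (c := [:: a]) hF indb) => i.
have -> : [set` [:: a]] = [set a].
  by apply/seteqP; split=> x /=; rewrite inE => /eqP.
by apply: sub_acl; [apply: fgen_subfield|apply: Fb].
Qed.

(** Each step of such a tower has transcendence degree at most one. *)
Lemma simple_tower_degree (m : nat) (F : nat -> set U) (a : nat -> U) f :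
    F 0%N = K -> (forall i, (i <= m)%N -> dsubfield delta (F i)) ->
    (forall i, (i < m)%N -> F i.+1 = fgen (F i `|` [set a i])) ->
    F m f -> X f -> ~ acl K f ->
  (n <= 1)%N.
Proof.
move=> F0 dF stepF Fmf Xf nf; apply: (tower_degree F0 dF _ Fmf Xf nf) => i im.
rewrite stepF //; split; first exact: subset_fgen1.
by apply: trdeg_le_fgen1; case: (dF i (ltnW im)).
Qed.

End StronglyMinimal.

(** * Prime differential ideals *)

Section DifferentialIdeals.
Variables (R : comNzRingType) (D : R -> R) (T M : set R).
Hypotheses (T1 : T 1) (TB : forall x y, T x -> T y -> T (x - y))
  (TM : forall x y, T x -> T y -> T (x * y)) (TD : forall x, T x -> T (D x)).
Hypotheses (DD : forall x y, T x -> T y -> D (x + y) = D x + D y)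
  (DM : forall x y, T x -> T y -> D (x * y) = D x * y + x * D y).
Hypotheses (MT : M `<=` T) (M1 : M 1) (MM : forall x y, M x -> M y -> M (x * y))
  (Mnat : forall n, M n.+1%:R) (M0 : ~ M 0).

Definition diff_ideal (J : set R) : Prop :=
  [/\ J `<=` T, forall x y, J x -> J y -> J (x + y),
      forall a x, T a -> J x -> J (a * x) & forall x, J x -> J (D x)].

Let T0 : T 0. Proof. by rewrite -(subrr 1); apply: TB. Qed.
Let TN x : T x -> T (- x). Proof. by rewrite -sub0r; apply: TB. Qed.
Let TX x k : T x -> T (x ^+ k).
Proof. by move=> Tx; elim: k => [|k IH]; rewrite ?expr0 // exprS; apply: TM. Qed.
Let MX x k : M x -> M (x ^+ k).
Proof. by move=> Mx; elim: k => [|k IH]; rewrite ?expr0 // exprS; apply: MM. Qed.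
Let Tadd x y : T x -> T y -> T (x + y).
Proof. by move=> Tx Ty; rewrite -[y]opprK; apply/TB/TN. Qed.

Let DX x k : T x -> D (x ^+ k.+1) = k.+1%:R * (x ^+ k * D x).
Proof.
move=> Tx; elim: k => [|k IH]; first by rewrite expr1 expr0 !mul1r.
by rewrite exprS DM ?IH; [rewrite -[k.+2%:R]natr1 exprS; ring|exact: Tx|exact: TX].
Qed.

Let idealN J x : diff_ideal J -> J x -> J (- x).
Proof. by move=> [_ _ JM _] Jx; rewrite -mulN1r; apply: JM => //; apply: TN. Qed.

Lemma max_diff_ideal : exists J, [/\ diff_ideal J, J 0, J `&` M = set0 &
  forall J', diff_ideal J' -> J' `&` M = set0 -> J `<=` J' -> J' `<=` J].
Proof.
pose P J := diff_ideal J /\ J `&` M = set0.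
(* The empty chain forces [P] to admit the empty set; that the maximal [J]
   contains [0] is checked afterwards. *)
have [|J [[idJ dJ] maxJ]] := @Zorn_bigcup _ P.
  move=> A AP totA; split; last first.
    apply/seteqP; split=> // x [[J AJ Jx] Mx].
    by have [_ <-] := AP J AJ; split.
  split.
  - by move=> x [J AJ Jx]; have [[JT _ _ _] _] := AP J AJ; apply: JT.
  - move=> x y [J AJ Jx] [J' AJ' Jy]; have [JJ|JJ] := totA J J' AJ AJ'.
      exists J' => //; have [[_ JD _ _] _] := AP J' AJ'.
      by apply: JD => //; apply: JJ.
    exists J => //; have [[_ JD _ _] _] := AP J AJ.
    by apply: JD => //; apply: JJ.
  - move=> a x Ta [J AJ Jx]; exists J => //.
    by have [[_ _ JM _] _] := AP J AJ; apply: JM.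
  - move=> x [J AJ Jx]; exists J => //.
    by have [[_ _ _ JD] _] := AP J AJ; apply: JD.
have max J' : diff_ideal J' -> J' `&` M = set0 -> J `<=` J' -> J' `<=` J.
  move=> idJ' dJ' JJ'; apply: contrapT => nJ.
  exact: (maxJ J' (conj JJ' nJ) (conj idJ' dJ')).
exists J; split=> //; have [JT JD JM JDer] := idJ.
have [[x Jx]|noJ] := pselect (J !=set0).
  by rewrite -(mul0r x); apply: JM.
have D0 : D 0 = 0 by apply: (addrI (D 0)); rewrite -DD // !addr0.
apply: (max [set 0]) => //.
- split=> [x ->|x y -> ->|a x _ ->|x ->] //=; rewrite ?addr0 ?mulr0 ?D0 //.
- by apply/seteqP; split=> // x [->].
by move=> x Jx; case: noJ; exists x.
Qed.

(** A maximal differential ideal [J] away from [M] is prime. The elements killed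
    modulo [J] by a power of [a] form a differential ideal, so if [a] is not
    nilpotent modulo [J] they all lie in [J]. The nilpotent elements form a
    differential ideal too, because [a ^+ k.+1] in [J] puts [a ^+ k * D a] in
    [J]; so they also lie in [J]. *)
Lemma prime_diff_ideal : exists J, [/\ diff_ideal J, J 0, J `&` M = set0 &
  forall a b, T a -> T b -> J (a * b) -> J a \/ J b].
Proof.
have [J [idJ J0 dJ maxJ]] := max_diff_ideal; exists J; split=> //.
have [JT JD JM JDer] := idJ.
have JMdis x : J x -> M x -> False.
  by move=> Jx Mx; have : (J `&` M) x by []; rewrite dJ.
pose sat a := [set b | T b /\ exists k, J (a ^+ k * b)].
have sat_sub a : T a -> (forall m, M m -> ~ sat a m) -> sat a `<=` J.
  move=> Ta satM; apply: maxJ; last first.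
  - by move=> b Jb; split; [apply: JT|exists 0%N; rewrite expr0 mul1r].
  - by apply/seteqP; split=> // m [am /satM].
  split=> [b []//|b c [Tb [k Jb]] [Tc [l Jc]]|c b Tc [Tb [k Jb]]|b [Tb [k Jb]]].
  - split; first exact: Tadd.
    exists (k + l)%N; rewrite mulrDr exprD; apply: JD.
      by rewrite -mulrA mulrCA; apply: JM; [apply: TX|].
    by rewrite -mulrA; apply: JM; [apply: TX|].
  - by split; [apply: TM|exists k; rewrite mulrCA; apply: JM].
  split; first exact: TD.
  exists k.+1; have := JDer _ Jb; rewrite DM //; last exact: TX.
  case: k Jb => [|k] Jb JDb.
    rewrite expr0 in Jb JDb *.
    have D1 : D 1 = 0 by have /esym/eqP := DM T1 T1; rewrite !mulr1 mul1r -subr_eq0 addrK => /eqP.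
    by move: JDb; rewrite D1 mul0r add0r mul1r expr1 => JDb; apply: JM.
  have := JD _ _ (JM a _ Ta JDb)
    (idealN idJ (JM (k.+1%:R * D a) _ (TM (MT (Mnat k)) (TD Ta)) Jb)).
  suff -> : a * (D (a ^+ k.+1) * b + a ^+ k.+1 * D b)
    - k.+1%:R * D a * (a ^+ k.+1 * b) = a ^+ k.+2 * D b by [].
  rewrite DX // [a ^+ k.+2]exprS [a ^+ k.+1]exprS.
  move: (a ^+ k) (k.+1%:R : R) => u v; ring.
have satM m b : M m -> T b -> J (m * b) -> J b.
  move=> Mm Tb Jmb; apply: (sat_sub m (MT Mm)); last first.
    by split=> //; exists 1%N; rewrite expr1.
  by move=> m' Mm' [_ [k Jk]]; apply: JMdis Jk _; apply: MM => //; apply: MX.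
have regular a b : T a -> (forall k, ~ J (a ^+ k)) -> T b -> J (a * b) -> J b.
  move=> Ta na Tb Jab; apply: (sat_sub a Ta); last first.
    by split=> //; exists 1%N; rewrite expr1.
  move=> m Mm [_ [k Jk]]; apply: (na k); apply: (satM m) => //; first exact: TX.
  by rewrite mulrC.
pose N := [set a | T a /\ exists k, J (a ^+ k)].
(* By [regular], [D a] is nilpotent when [k] is the least exponent with
   [a ^+ k] in [J]. *)
have NJ : N `<=` J.
  apply: maxJ; last first.
  - by move=> a Ja; split; [apply: JT|exists 1%N; rewrite expr1].
  - apply/seteqP; split=> // m [[_ [k Jk]] Mm].
    by apply: JMdis Jk _; apply: MX.
  have Jhigh a k i : T a -> J (a ^+ k) -> (k <= i)%N -> J (a ^+ i).
    by move=> Ta Jk ki; rewrite -(subnK ki) exprD; apply: JM => //; apply: TX.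
  split=> [a []//|a b [Ta [k Ja]] [Tb [l Jb]]|c a Tc [Ta [k Ja]]|a [Ta exk]].
  - split; first exact: Tadd.
    exists (k + l)%N; rewrite exprDn; apply: (big_ind J) => // i _.
    rewrite -mulr_natl; apply: (JM _ _).
      by case: 'C(_, _) => [|t] //; apply: MT.
    have [il|li] := leqP i l.
      rewrite mulrC; apply: JM; first exact: TX.
      by apply: Jhigh Ja _ => //; rewrite -addnBA // leq_addr.
    by apply: JM; [apply: TX|apply: Jhigh Jb _ => //; apply: ltnW].
  - split; first exact: TM.
    by exists k; rewrite exprMn; apply: JM => //; apply: TX.
  split; first exact: TD.
  have exk' : exists k, `[< J (a ^+ k) >] by case: exk => k Jk; exists k; apply/asboolP.
  case: (ex_minnP exk') => -[|k] /asboolP Jk mink.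
    by case: (JMdis 1).
  have JaD : J (D a * a ^+ k).
    rewrite mulrC; apply: (satM k.+1%:R) => //; first exact: TM (TX _ Ta) (TD Ta).
    by rewrite -DX //; apply: JDer.
  apply: contrapT => nDa; have : J (a ^+ k).
    apply: regular JaD; [exact: TD| |exact: TX].
    by move=> i Ji; apply: nDa; exists i.
  by move/asboolP/mink; rewrite ltnn.
move=> a b Ta Tb Jab; have [na|na] := pselect (exists k, J (a ^+ k)).
  by left; apply: NJ.
right; apply: (regular a) => // k Jk; apply: na; by exists k.
Qed.

End DifferentialIdeals.

(** * Extending partial embeddings into a saturated differentially closed field *)

Definition enumerable (T : Type) (S : set T) : Prop :=
  exists e : nat -> T, S `<=` range e.

Section FirstOrderEquations.
Variables (U : fieldType) (delta : U -> U) (hU : DCF0 delta).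

Let hd : derivation delta.
Proof. by case: hU. Qed.

Let char0 : [pchar U] =i pred0.
Proof. by case: hU. Qed.

Definition mpoly1 (q : {poly U}) : mpoly 1 U := unmuni (map_poly (@mpolyC 0 U) q).

Lemma deval_mpoly1 q z : deval delta (mpoly1 q) z = q.[z].
Proof.
rewrite /deval meval_unmuni -map_poly_comp /=; congr (_.[_]).
apply/polyP=> i; rewrite coef_map_id0 /= ?mevalC //.
Qed.

Lemma mpoly1_neq0 q : q != 0 -> mpoly1 q != 0.
Proof.
apply: contra_neq => /(congr1 (@muni 0 U)); rewrite unmuniK muni0 => q0.
apply/polyP=> i; have /polyP/(_ i) := q0; rewrite coef_map !coef0 /= => /eqP.
by rewrite mpolyC_eq0 => /eqP.
Qed.

Lemma mderiv_mpoly1 q : mderiv ord_max (mpoly1 q) = mpoly1 q^`().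
Proof. by rewrite /mpoly1 mderiv_unmuni deriv_map. Qed.

Lemma dcf_root (q : {poly U}) : (1 < size q)%N -> exists z, q.[z] = 0.
Proof.
move=> zq; have [_ _ blum] := hU.
have [||z [qz _]] := blum 0%N (mpoly1 q) 1; rewrite ?oner_eq0 //.
  by rewrite mderiv_mpoly1; apply/mpoly1_neq0/deriv_neq0.
by exists z; rewrite -deval_mpoly1.
Qed.

Lemma dcf_first_order (p h : {poly U}) : h != 0 ->
  exists z, delta z = p.[z] /\ h.[z] != 0.
Proof.
move=> h0; have [_ _ blum] := hU.
have [||z [pz hz]] := blum 1%N (unmuni ('X - (mpoly1 p)%:P)) (mpoly1 h).
- rewrite mderiv_unmuni derivB derivX derivC subr0 -polyC1 unmuniC mwiden1.
  exact: oner_neq0.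
- exact: mpoly1_neq0.
exists z; rewrite -(deval_mpoly1 h); split=> //; move: pz.
rewrite {1}/deval meval_unmuni rmorphB /= map_polyX map_polyC hornerD hornerN.
rewrite hornerX hornerC /= => /eqP; rewrite subr_eq0 => /eqP ->.
by rewrite -(deval_mpoly1 p).
Qed.

Lemma poly_term (C : set U) (p : {poly U}) : C 0 -> (forall i, C p`_i) ->
  exists2 t : dterm U, dterm_params t `<=` C &
    forall y, dterm_eval delta (fun i => if i == 0%N then y else 0) t = p.[y].
Proof.
move=> C0; elim/poly_ind: p => [_|p c IH Cp].
  by exists (DConst 0) => [_ ->|y] //=; rewrite horner0.
have [|t Ct Dt] := IH.
  by move=> i; have := Cp i.+1; rewrite coefD coefMX coefC addr0.
exists (DAdd (DMul t (DVar U 0)) (DConst c)).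
  move=> x /= [[/Ct|]//|->].
  by have := Cp 0%N; rewrite coefD coefMX coefC add0r.
by move=> y /=; rewrite Dt !hornerE.
Qed.

(** Any finitely many of the inequations [q.[z] != 0] amount to a single one of
    order zero, which Blum's axiom at order one can satisfy together with the
    equation; saturation then satisfies all of them. *)
Lemma saturated_first_order (C : set U) (p : {poly U}) :
    saturated delta -> ~ ([set: U] #<= C)%card -> C 0 -> (forall i, C p`_i) ->
  exists z, delta z = p.[z] /\
    forall q : {poly U}, (forall i, C q`_i) -> q != 0 -> q.[z] != 0.
Proof.
move=> hsat ncard C0 Cp.
pose is_eq (phi : dform U) := forall y, dform_sat1 delta phi y <-> delta y = p.[y].
pose is_neq (phi : dform U) (q : {poly U}) :=
  forall y, dform_sat1 delta phi y <-> q.[y] != 0.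
pose Phi : set (dform U) := [set phi | dform_params phi `<=` C /\
  (is_eq phi \/ exists q, q != 0 /\ is_neq phi q)].
have [|F finF FPhi|z Hz] := hsat C Phi ncard; first by move=> phi [].
- have [h h0 Hh] : exists2 h : {poly U}, h != 0 & forall y, delta y = p.[y] ->
      h.[y] != 0 -> forall phi, F phi -> dform_sat1 delta phi y.
    have [s Ds] : exists s : seq (dform U), forall phi, F phi <-> List.In phi s.
      have /(@finite_seqP {classic dform U})[s Ds] := finF.
      exists s => phi; rewrite Ds /= {Ds finF FPhi}; elim: s => //= psi s IH.
      rewrite (in_cons (psi : {classic dform U})); split.
        by case/orP=> [/eqP->|/IH]; [left|right].
      by case=> [->|/IH ->]; rewrite ?eqxx ?orbT.
    have : forall phi, List.In phi s -> Phi phi by move=> phi /Ds; apply: FPhi.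
    have : forall phi, F phi -> List.In phi s by move=> phi /Ds.
    elim: s F {finF FPhi Ds} => [|phi s IH] F Fs sPhi.
      by exists 1; rewrite ?oner_neq0 // => y _ _ psi /Fs.
    have [//|psi ss|h h0 Hh] := IH [set psi | List.In psi s].
      by apply: sPhi; right.
    have [_ [eqphi|[q [q0 neqphi]]]] := sPhi phi (or_introl erefl).
      exists h => // y py hy psi /Fs[<-|ss]; first exact/eqphi.
      exact: Hh.
    exists (h * q); first exact: mulf_neq0.
    move=> y py; rewrite hornerM mulf_eq0 negb_or => /andP[hy qy] psi /Fs[<-|ss].
      exact/neqphi.
    exact: Hh.
  by have [y [py hy]] := dcf_first_order p h0; exists y; apply: Hh.
have term0 (q : {poly U}) : (forall i, C q`_i) -> _ := @poly_term C q C0.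
exists z; split=> [|q Cq q0].
  have [t Ct Dt] := term0 p Cp.
  have is_eq_phi : is_eq (DEq (DDer (DVar U 0)) t).
    by move=> y; rewrite /dform_sat1 /= Dt.
  apply/is_eq_phi/Hz; split; last by left.
  by move=> x /= [//|/Ct].
have [t Ct Dt] := term0 q Cq.
have is_neq_phi : is_neq (DNot (DEq t (DConst 0))) q.
  by move=> y; rewrite /dform_sat1 /= Dt; split=> /eqP.
apply/is_neq_phi/Hz; split; last by right; exists q.
by move=> x /= [/Ct//|->].
Qed.

End FirstOrderEquations.

(** [U] contains the complex numbers, which are uncountable. *)
Lemma not_card_le_enumerable (R : realType) (U : fieldType)
    (iota : {rmorphism Cplx R -> U}) (C : set U) :
  enumerable C -> ~ ([set: U] #<= C)%card.
Proof.
move=> [e Ce] UC.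
have cU : countable [set: U].
  apply: sub_countable UC _; apply: (@sub_countable _ _ _ (range e)).
    exact: subset_card_le.
  by apply: sub_countable (card_image_le _ _) _; apply: countableP.
have /countable_injP[g injg] := cU.
have cR : countable [set: R].
  apply/countable_injP; exists (fun r => g (iota (real_complex R r))).
  move=> x y _ _ /injg; rewrite !inE => /(_ Logic.I Logic.I)/fmorph_inj[].
  by [].
have c01 : countable ([set` `[0%R, 1%R]] : set R).
  by apply: sub_countable cR; exact: subset_card_le.
have := countable_lebesgue_measure0 c01.
rewrite lebesgue_measure_itv /= lte_fin ltr01 oppr0 adde0 => /eqP.
by rewrite eqe oner_eq0.
Qed.

Definition subring (R : comNzRingType) (S : set R) : Prop :=
  [/\ S 1, forall x y, S x -> S y -> S (x - y)
    & forall x y, S x -> S y -> S (x * y)].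

Definition mem_sub (R : comNzRingType) (S : set R) (hS : subring S) : {pred R} :=
  fun x => `[< S x >].

Lemma mem_subP (R : comNzRingType) (S : set R) (hS : subring S) x :
  reflect (S x) (x \in mem_sub hS).
Proof. exact: asboolP. Qed.

Lemma mem_sub_subring (R : comNzRingType) (S : set R) (hS : subring S) :
  subring_closed (mem_sub hS).
Proof.
have [S1 SB SM] := hS.
by split=> [|x y /mem_subP Sx /mem_subP Sy|x y /mem_subP Sx /mem_subP Sy];
  apply/mem_subP; [|apply: SB|apply: SM].
Qed.

HB.instance Definition _ (R : comNzRingType) (S : set R) (hS : subring S) :=
  GRing.isSubringClosed.Build R (mem_sub hS) (mem_sub_subring hS).

Section Adjoin.
Variables (R : comNzRingType).
Implicit Types (S T : set R).

Lemma polyOver_subP S (hS : subring S) (Q : {poly R}) :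
  (forall i, S Q`_i) <-> Q \is a polyOver (mem_sub hS).
Proof.
by split=> [SQ|/polyOverP SQ i]; [apply/polyOverP=> i|]; apply/(mem_subP hS).
Qed.

Definition adjoin S (y : R) : set R :=
  [set x | exists2 Q : {poly R}, forall i, S Q`_i & x = Q.[y]].

Lemma sub_adjoin S y : subring S -> S `<=` adjoin S y.
Proof.
move=> hS x Sx; exists x%:P; last by rewrite hornerC.
by apply/(polyOver_subP hS); rewrite polyOverC; apply/mem_subP.
Qed.

Lemma mem_adjoin S y : subring S -> adjoin S y y.
Proof.
move=> hS; exists 'X; last by rewrite hornerX.
by apply/(polyOver_subP hS); apply: polyOverX.
Qed.

Lemma adjoin_subring S y : subring S -> subring (adjoin S y).
Proof.
move=> hS; have SP := polyOver_subP hS; split.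
- by apply: (sub_adjoin y hS); case: (hS).
- move=> _ _ [P /SP SP1 ->] [Q /SP SQ ->]; exists (P - Q); rewrite ?hornerD ?hornerN //.
  by apply/SP/rpredB.
move=> _ _ [P /SP SP1 ->] [Q /SP SQ ->]; exists (P * Q); rewrite ?hornerM //.
by apply/SP/rpredM.
Qed.

Lemma adjoin_min S T y : subring T -> S `<=` T -> T y -> adjoin S y `<=` T.
Proof.
move=> hT ST Ty _ [Q SQ ->]; apply/(mem_subP hT); rewrite horner_coef.
by apply: rpred_sum => i _; rewrite rpredM ?rpredX //; apply/mem_subP => //; apply: ST.
Qed.

Lemma adjoin_enumerable S y : enumerable S -> enumerable (adjoin S y).
Proof.
move=> [e Se]; exists (fun n =>
  (Poly (map e (odflt [::] (choice.unpickle n)))).[y]) => _ [Q SQ ->].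
have /choice[c Dc] : forall i, exists n, e n = Q`_i.
  by move=> i; have [n _ <-] := Se _ (SQ i); exists n.
exists (choice.pickle (mkseq c (size Q))) => //.
rewrite choice.pickleK /=; congr (_.[y]); apply/polyP=> i; rewrite coef_Poly.
have [iQ|Qi] := ltnP i (size Q).
  by rewrite (nth_map 0%N) ?size_mkseq // nth_mkseq.
by rewrite !nth_default // size_map size_mkseq.
Qed.

Lemma der_horner (D : R -> R) T (hT : subring T) :
    (forall x y, T x -> T y -> D (x + y) = D x + D y) ->
    (forall x y, T x -> T y -> D (x * y) = D x * y + x * D y) ->
  forall (Q : {poly R}) y, (forall i, T Q`_i) -> T y ->
    D Q.[y] = (map_poly D Q).[y] + Q^`().[y] * D y.
Proof.
move=> DD DM Q y TQ Ty.
have T0 : T 0 by apply/(mem_subP hT)/rpred0.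
have D0 : D 0 = 0 by apply: (addrI (D 0)); rewrite -DD // !addr0.
elim/poly_ind: Q TQ => [_|Q c IH TQc].
  by rewrite linear0 map_poly0 !horner0 D0 mul0r addr0.
have TQ i : T Q`_i by have := TQc i.+1; rewrite coefD coefMX coefC addr0.
have Tc : T c by have := TQc 0%N; rewrite coefD coefMX coefC add0r.
have TQy : T Q.[y].
  by apply: (@adjoin_min T T y) => //; exists Q.
have -> : map_poly D (Q * 'X + c%:P) = map_poly D Q * 'X + (D c)%:P.
  apply/polyP=> i; rewrite coef_map_id0 // !coefD !coefMX !coefC.
  by case: i => [|i]; rewrite ?add0r ?addr0 //= coef_map_id0.
rewrite derivD derivM derivX derivC addr0 mulr1 !hornerE.
rewrite DD ?DM ?IH //; first by ring.
by case: hT => _ _; apply.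
Qed.

End Adjoin.

(** [psi] induces an embedding of the countable differential ring
    [S / (J cap S)] into [U]. *)
Record place (R : comNzRingType) (D : R -> R) (T J : set R) (U : fieldType)
    (delta : U -> U) (S : set R) (psi : R -> U) : Prop := Place {
  place_subring : subring S;
  place_sub : S `<=` T;
  place_closed : forall x, S x -> S (D x);
  place_enumerable : enumerable S;
  place1 : psi 1 = 1;
  placeB : forall x y, S x -> S y -> psi (x - y) = psi x - psi y;
  placeM : forall x y, S x -> S y -> psi (x * y) = psi x * psi y;
  place_der : forall x, S x -> psi (D x) = delta (psi x);
  place_ker : forall x, S x -> psi x = 0 <-> J x }.

Section ExtendPlace.
Variables (R : comNzRingType) (D : R -> R) (T J : set R).
Hypothesis hT : subring T.
Hypotheses (DD : forall x y, T x -> T y -> D (x + y) = D x + D y)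
  (DM : forall x y, T x -> T y -> D (x * y) = D x * y + x * D y).
Hypotheses (idJ : diff_ideal D T J) (J0 : J 0)
  (primeJ : forall a b, T a -> T b -> J (a * b) -> J a \/ J b).
Variables (U : fieldType) (delta : U -> U) (hU : DCF0 delta).
Hypotheses (hsat : saturated delta)
  (ncard : forall C : set U, enumerable C -> ~ ([set: U] #<= C)%card).
Variables (S : set R) (psi : R -> U) (hpsi : place D T J delta S psi).
Variables (y : R) (Ty : T y) (p : {poly R}) (Sp : forall i, S p`_i)
  (Dy : D y = p.[y]).

Let hS := place_subring hpsi.
Notation over := (polyOver (mem_sub hS)).
Notation mpsi := (map_poly psi).
Implicit Types P Q G : {poly R}.

Let SP Q : (forall i, S Q`_i) <-> Q \is a over := polyOver_subP hS Q.

Let hd : derivation delta.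
Proof. by case: hU. Qed.

Let char0 : [pchar U] =i pred0.
Proof. by case: hU. Qed.

Let ST := place_sub hpsi.

Let JD x z : J x -> J z -> J (x + z).
Proof. by case: idJ => _ h _ _; apply: h. Qed.

Let JM a x : T a -> J x -> J (a * x).
Proof. by case: idJ => _ _ h _; apply: h. Qed.

Let JN x : J x -> J (- x).
Proof.
move=> Jx; rewrite -mulN1r; apply: JM => //.
by apply/(mem_subP hT); rewrite rpredN rpred1.
Qed.

Let psi0 : psi 0 = 0.
Proof.
have [S1 _ _] := hS.
by rewrite -(subrr (1 : R)) (placeB hpsi) // subrr.
Qed.

Let psiB' : {in mem_sub hS &, forall x z, psi (x - z) = psi x - psi z}.
Proof. by move=> x z /mem_subP Sx /mem_subP Sz; apply: (placeB hpsi). Qed.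

Let psiM' : {in mem_sub hS &, forall x z, psi (x * z) = psi x * psi z}.
Proof. by move=> x z /mem_subP Sx /mem_subP Sz; apply: (placeM hpsi). Qed.



Lemma T_horner Q : Q \is a over -> T Q.[y].
Proof.
move=> /SP SQ; apply: (@adjoin_min R T T y) => //.
by exists Q => // i; apply/ST/SQ.
Qed.

Lemma J_horner Q : Q \is a over -> mpsi Q = 0 -> J Q.[y].
Proof.
move=> /SP SQ Q0; rewrite horner_coef; apply: (big_ind J) => // i _.
rewrite mulrC; apply: JM; first by apply/(mem_subP hT)/rpredX/mem_subP.
apply/(place_ker hpsi) => //.
by have /polyP/(_ i) := Q0; rewrite coef_map_id0 // coef0.
Qed.


Lemma coef_mpsi Q i : (mpsi Q)`_i = psi Q`_i.
Proof. exact: coef_map_id0. Qed.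

Lemma mpsi_deriv Q : Q \is a over -> mpsi Q^`() = (mpsi Q)^`().
Proof.
move=> /SP SQ; apply/polyP=> i; rewrite coef_mpsi !coef_deriv coef_mpsi.
have : Q`_i.+1 \in mem_sub hS by apply/mem_subP.
move: (Q`_i.+1) => c Sc; elim: i.+1 => [|k IH]; first by rewrite !mulr0n psi0.
by rewrite !mulrSr (part_morphD psiB') ?IH // rpredMn.
Qed.

Lemma deriv_over Q : Q \is a over -> Q^`() \is a over.
Proof.
by move=> SQ; apply/polyOverP=> i; rewrite coef_deriv rpredMn //; apply/polyOverP.
Qed.

Lemma D0 : D 0 = 0.
Proof.
have T0 : T 0 by apply/(mem_subP hT)/rpred0.
by apply: (addrI (D 0)); rewrite -DD // !addr0.
Qed.

Lemma mapD_over Q : Q \is a over -> map_poly D Q \is a over.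
Proof.
move=> /SP SQ; apply/SP => i; rewrite coef_map_id0 ?D0 //.
exact: (place_closed hpsi).
Qed.

Lemma mpsi_mapD Q : Q \is a over -> mpsi (map_poly D Q) = map_poly delta (mpsi Q).
Proof.
move=> /SP SQ; apply/polyP=> i; rewrite coef_mpsi !coef_map_id0 ?D0 ?(der0 hd) //.
exact: (place_der hpsi).
Qed.

Lemma D_horner Q : Q \is a over ->
  D Q.[y] = (map_poly D Q + Q^`() * p).[y].
Proof.
move=> /SP SQ; rewrite hornerD hornerM -Dy; apply: (der_horner hT) => // i.
exact/ST/SQ.
Qed.

Lemma delta_horner Q z : Q \is a over ->
  delta (mpsi Q).[z] = (mpsi (map_poly D Q)).[z] + (mpsi Q^`()).[z] * delta z.
Proof.
move=> SQ; rewrite mpsi_mapD // mpsi_deriv //.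
have hU0 : subring [set: U] by [].
by apply: (der_horner hU0) => // u v _ _; [apply: derD|apply: derM].
Qed.

(** If [y] is transcendental over [S] modulo [J], its image must be a
    transcendental solution of the transported equation. *)
Lemma transcendental_image :
    (forall Q, Q \is a over -> J Q.[y] -> mpsi Q = 0) ->
  exists z, delta z = (mpsi p).[z] /\
    forall Q, Q \is a over -> J Q.[y] <-> (mpsi Q).[z] = 0.
Proof.
move=> trans; have [S1 _ _] := hS; have S0 : S 0 by apply/(mem_subP hS)/rpred0.
have CQ Q : Q \is a over -> forall i, (psi @` S) (mpsi Q)`_i.
  by move=> /SP SQ i; rewrite coef_mpsi; exists Q`_i.
have enC : enumerable (psi @` S).
  have [e Se] := place_enumerable hpsi; exists (psi \o e) => _ [x /Se[i _ <-] <-].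
  by exists i.
have [||z [pz zC]] := @saturated_first_order U delta hU (psi @` S) (mpsi p) hsat (ncard enC).
- by exists 0.
- by apply: CQ; apply/SP.
exists z; split=> // Q SQ; split=> [/(trans Q SQ)->|Qz]; first by rewrite horner0.
apply: J_horner => //; apply: contra_eq Qz => Q0; exact: zC (CQ Q SQ) Q0.
Qed.

(** If [y] is algebraic over [S] modulo [J], its image is any root [z] of a
    shortest equation [G] of [y]: up to factors from [S], a polynomial vanishing
    at [y] is a multiple of [G], and [G] is irreducible. *)
Section AlgebraicImage.
Variable G : {poly R}.
Hypotheses (SG : G \is a over) (JG : J G.[y]) (G0 : mpsi G != 0).
Hypothesis minG : forall Q, Q \is a over -> J Q.[y] -> mpsi Q != 0 ->
  (size (mpsi G) <= size (mpsi Q))%N.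
Variables (z : U) (Gz : (mpsi G).[z] = 0).

Let mpsiD Q P : Q \is a over -> P \is a over -> mpsi (Q + P) = mpsi Q + mpsi P.
Proof. by move=> SQ SP'; apply: (part_polyD psiB' SQ SP'). Qed.

Let mpsiM Q P : Q \is a over -> P \is a over -> mpsi (Q * P) = mpsi Q * mpsi P.
Proof. by move=> SQ SP'; apply: (part_polyM psiB' psiM' SQ SP'). Qed.

Let mpsiC c : mpsi c%:P = (psi c)%:P.
Proof. exact: (part_polyC psiB'). Qed.

Let overC c : c \in mem_sub hS -> c%:P \is a over.
Proof. by rewrite polyOverC. Qed.

Lemma min_zero Q : Q \is a over -> J Q.[y] ->
  (size (mpsi Q) < size (mpsi G))%N -> mpsi Q = 0.
Proof.
move=> SQ JQ small; apply/eqP; apply: contraTT small => Q0.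
by rewrite -leqNgt minG.
Qed.

Lemma kernel_to_root Q : Q \is a over -> J Q.[y] -> (mpsi Q).[z] = 0.
Proof.
move=> SQ JQ.
have [c [A [Rm [Sc c0 SA SR [E zR]]]]] := pseudo_div (place1 hpsi) psiB' psiM' SQ SG G0.
have ER : Rm.[y] = c * Q.[y] + - (A.[y] * G.[y]).
  by rewrite -(hornerM A) -(hornerCM c) E hornerD; ring.
have Rm0 : mpsi Rm = 0.
  apply: min_zero => //; rewrite ER; apply: JD.
    by apply: JM => //; apply: ST; apply/mem_subP.
  by apply/JN/JM => //; apply: T_horner.
have := congr1 (fun P => (mpsi P).[z]) E.
rewrite /= mpsiD ?rpredM // !mpsiM ?overC // mpsiC Rm0 addr0 hornerCM hornerM Gz.
by rewrite mulr0 => /eqP; rewrite mulf_eq0 (negbTE c0) => /eqP.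
Qed.

Lemma root_to_kernel Q : Q \is a over -> (mpsi Q).[z] = 0 -> J Q.[y].
Proof.
have [m] := ubnP (size (mpsi Q)); elim: m Q => // m IH Q; rewrite ltnS => zQ SQ Qz.
have [Q0|Q0] := eqVneq (mpsi Q) 0; first exact: J_horner.
have nJ c : c \in mem_sub hS -> psi c != 0 -> ~ J c.
  by move=> /mem_subP Sc c0 /(place_ker hpsi Sc)/eqP; rewrite (negbTE c0).
have Tc c : c \in mem_sub hS -> T c by move=> /mem_subP Sc; apply: ST.
have [big|small] := leqP (size (mpsi G)) (size (mpsi Q)).
  have [c [A [Rm [Sc c0 SA SR [E zR]]]]] := pseudo_div (place1 hpsi) psiB' psiM' SQ SG G0.
  have JR : J Rm.[y].
    apply: IH => //; first exact: leq_trans zR (leq_trans big zQ).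
    have := congr1 (fun P => (mpsi P).[z]) E.
    rewrite /= mpsiD ?rpredM // !mpsiM ?overC // mpsiC hornerD hornerCM hornerM.
    by rewrite Gz Qz !mulr0 add0r.
  have : J (c * Q.[y]).
    by rewrite -hornerCM E hornerD hornerM; apply: JD => //; apply: JM => //; apply: T_horner.
  by case/(primeJ (Tc c Sc) (T_horner SQ)) => // /(nJ c Sc c0).
have [zQ1|zQ1] := leqP (size (mpsi Q)) 1.
  by move: Qz Q0; rewrite (size1_polyC zQ1) hornerC => ->; rewrite eqxx.
have [c [A [Rm [Sc c0 SA SR [E zR]]]]] := pseudo_div (place1 hpsi) psiB' psiM' SG SQ Q0.
have Em : (psi c)%:P * mpsi G = mpsi A * mpsi Q + mpsi Rm.
  by rewrite -mpsiC -!mpsiM ?overC // E mpsiD // rpredM.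
have JR : J Rm.[y].
  apply: IH => //; first exact: leq_trans zR zQ.
  have := congr1 (fun P : {poly U} => P.[z]) Em.
  by rewrite /= hornerCM hornerD hornerM Gz Qz !mulr0 add0r.
have R0 : mpsi Rm = 0 by apply: min_zero => //; apply: ltn_trans zR small.
have : J (A.[y] * Q.[y]).
  have -> : A.[y] * Q.[y] = c * G.[y] + - Rm.[y].
    by rewrite -(hornerCM c) E hornerD hornerM; ring.
  by apply: JD; [apply: JM => //; apply: Tc|apply: JN].
case/(primeJ (T_horner SA) (T_horner SQ)) => // JA.
have A0 : mpsi A != 0.
  apply: contraTneq isT => A0; move/eqP: Em.
  by rewrite A0 R0 mul0r addr0 mulf_eq0 polyC_eq0 (negbTE c0) (negbTE G0).
have := minG SA JA A0; rewrite leqNgt.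
have := congr1 (size : {poly U} -> nat) Em.
rewrite R0 addr0 size_Cmul // size_mul // => ->.
by rewrite -subn1 -addnBA ?(ltnW zQ1) // -{1}[size (mpsi A)]addn0 ltn_add2l subn_gt0 zQ1.
Qed.

(** A shortest equation involves [y]: its coefficients cannot all but the
    constant one lie in [J]. *)
Lemma size_min_gt1 : (1 < size (mpsi G))%N.
Proof.
rewrite ltnNge; apply: contraNN G0 => zG.
have sG0 : S G`_0 by move/SP: SG; apply.
have SG0 : (G`_0)%:P \is a over by rewrite overC //; apply/mem_subP.
have J_G0 : J G`_0.
  have -> : G`_0 = G.[y] + - (G - (G`_0)%:P).[y] by rewrite hornerD hornerN hornerC; ring.
  apply: JD => //; apply/JN/J_horner; first exact: rpredB.
  rewrite (part_polyB psiB' SG SG0) mpsiC (size1_polyC zG).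
  by rewrite coef_mpsi subrr.
by rewrite (size1_polyC zG) coef_mpsi polyC_eq0; apply/eqP/(place_ker hpsi).
Qed.

(** Differentiating [G] at [y] and at [z] gives the same linear equation for
    [D y] and [delta z]. *)
Lemma root_delta : delta z = (mpsi p).[z].
Proof.
have SG' := deriv_over SG; have SDG := mapD_over SG.
have Sp' : p \is a over by apply/SP.
have G'z : (mpsi G^`()).[z] != 0.
  apply/eqP => /(root_to_kernel SG') JG'.
  have G'0 : mpsi G^`() != 0.
    by rewrite mpsi_deriv //; apply: deriv_neq0 char0 size_min_gt1.
  have := minG SG' JG' G'0; rewrite mpsi_deriv // leqNgt.
  by rewrite (leq_ltn_trans (size_poly _ _)) //; case: (size _) size_min_gt1.
have JDG : J (map_poly D G + G^`() * p).[y].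
  by rewrite -D_horner //; case: idJ => _ _ _; apply.
have SGp : G^`() * p \is a over by apply: rpredM.
have := kernel_to_root (rpredD SDG SGp) JDG.
rewrite mpsiD ?rpredM // mpsiM // hornerD hornerM.
have := delta_horner z SG; rewrite Gz (der0 hd) => /esym/eqP.
rewrite addrC addr_eq0 => /eqP DG /eqP; rewrite addrC addr_eq0 => /eqP pG.
by apply: (mulfI G'z); rewrite DG pG.
Qed.

End AlgebraicImage.

Lemma image_point : exists z, delta z = (mpsi p).[z] /\
  forall Q, Q \is a over -> J Q.[y] <-> (mpsi Q).[z] = 0.
Proof.
pose alg m := `[< exists Q, [/\ Q \is a over, J Q.[y], mpsi Q != 0 & size (mpsi Q) = m] >].
have [exm|none] := pselect (exists m, alg m); last first.
  apply: transcendental_image => Q SQ JQ; apply/eqP; apply: contra_notT none => Q0.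
  by exists (size (mpsi Q)); apply/asboolP; exists Q.
case: (ex_minnP exm) => m /asboolP[G [SG JG G0 zG]] minm.
have minG Q : Q \is a over -> J Q.[y] -> mpsi Q != 0 ->
    (size (mpsi G) <= size (mpsi Q))%N.
  by move=> SQ JQ Q0; rewrite zG; apply/minm/asboolP; exists Q.
have [z Gz] := dcf_root hU (size_min_gt1 SG JG G0).
exists z; split; first exact: (root_delta SG JG G0 minG Gz).
move=> Q SQ; split; first exact: (kernel_to_root SG JG G0 minG Gz).
exact: (root_to_kernel SG JG G0 minG Gz).
Qed.

Lemma extend_place : exists psi',
  place D T J delta (adjoin S y) psi' /\ forall x, S x -> psi' x = psi x.
Proof.
have [z [pz kerz]] := image_point.
(* [psi'] sends [Q.[y]] to [(mpsi Q).[z]]; by [kerz] this depends on the value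
   [Q.[y]] only. *)
have /choice[psi' Dpsi'] : forall x, exists u, forall Q, Q \is a over ->
    x = Q.[y] -> u = (mpsi Q).[z].
  move=> x; have [[Q0 [SQ0 Dx]]|none] :=
      pselect (exists Q, Q \is a over /\ x = Q.[y]); last first.
    by exists 0 => Q SQ Dx; case: none; exists Q.
  exists (mpsi Q0).[z] => Q SQ; rewrite Dx => EQ; apply/eqP; rewrite -subr_eq0.
  rewrite -hornerN -hornerD -(part_polyB psiB' SQ0 SQ); apply/eqP.
  by apply/kerz; [apply: rpredB|rewrite hornerD hornerN EQ subrr].
have psiE Q : Q \is a over -> psi' Q.[y] = (mpsi Q).[z] by move=> SQ; apply: Dpsi'.
exists psi'; split; last first.
  move=> x Sx; have Sxp : x%:P \is a over by rewrite polyOverC; apply/mem_subP.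
  by rewrite -[x in LHS](hornerC x y) psiE // (part_polyC psiB') hornerC.
split.
- exact: adjoin_subring.
- by apply: adjoin_min => //; apply: ST.
- move=> _ [Q /SP SQ ->]; rewrite D_horner //; exists (map_poly D Q + Q^`() * p) => //.
  by apply/SP; rewrite rpredD ?mapD_over // rpredM ?deriv_over //; apply/SP.
- by apply: adjoin_enumerable; apply: place_enumerable hpsi.
- rewrite -[1 in LHS](hornerC 1 y) psiE ?polyOverC ?rpred1 //.
  by rewrite (part_polyC psiB') hornerC (place1 hpsi).
- move=> _ _ [P /SP SP1 ->] [Q /SP SQ ->].
  rewrite -hornerN -hornerD !psiE ?rpredB //.
  by rewrite (part_polyB psiB' SP1 SQ) hornerD hornerN.
- move=> _ _ [P /SP SP1 ->] [Q /SP SQ ->].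
  rewrite -hornerM !psiE ?rpredM //.
  by rewrite (part_polyM psiB' psiM' SP1 SQ) hornerM.
- move=> _ [Q /SP SQ ->]; rewrite D_horner // !psiE //; last first.
    by rewrite rpredD ?mapD_over // rpredM ?deriv_over //; apply/SP.
  rewrite delta_horner // pz; have SDQ := mapD_over SQ.
  have SQ'p : Q^`() * p \is a over by rewrite rpredM ?deriv_over //; apply/SP.
  rewrite (part_polyD psiB' SDQ SQ'p) hornerD; congr (_ + _).
  rewrite (part_polyM psiB' psiM' (deriv_over SQ) (iffLR (SP p) Sp)).
  by rewrite hornerM.
move=> _ [Q /SP SQ ->]; rewrite psiE //; split=> [/kerz|/kerz] h; exact: h.
Qed.

End ExtendPlace.

(** * Pfaffian functions *)

Inductive simple_tower (U : fieldType) (delta : U -> U) (K : set U) : set U -> Prop :=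
| SimpleTower0 : simple_tower delta K K
| SimpleTowerS F a : simple_tower delta K F ->
    dsubfield delta (fgen (F `|` [set a])) ->
    simple_tower delta K (fgen (F `|` [set a])).

Lemma simple_tower_chain (U : fieldType) (delta : U -> U) (K F : set U) :
    dsubfield delta K -> simple_tower delta K F ->
  exists (m : nat) (E : nat -> set U) (a : nat -> U),
    [/\ E 0%N = K, E m = F, forall i, (i <= m)%N -> dsubfield delta (E i)
      & forall i, (i < m)%N -> E i.+1 = fgen (E i `|` [set a i])].
Proof.
move=> dK; elim=> [|{}F a _ [m [E [b [E0 Em dE stepE]]]] dF].
  by exists 0%N, (fun=> K), (fun=> 0); split.
exists m.+1, (fun i => if (i <= m)%N then E i else fgen (F `|` [set a])),
  (fun i => if (i < m)%N then b i else a).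
split; rewrite ?ltnn //.
  by move=> i _; case: (leqP i m) => // im; apply: dE.
move=> i; rewrite ltnS => im; rewrite im.
case: ltnP => [/stepE //|mi]; have -> : i = m by apply/eqP; rewrite eqn_leq im.
by rewrite Em.
Qed.

Section DirectionalDerivative.
Variables (R : realType) (m : nat) (D : set 'rV[Cplx R]_m) (x0 : 'rV[Cplx R]_m).
Hypotheses (oD : open D) (Dx0 : D x0).
Variable v : 'rV[Cplx R]_m.
Notation C := (Cplx R).
Notation fct := ('rV[C]_m -> C).

(** Functions on [D] are represented by total functions that are constant along
    the retraction [retr] onto [D]; equality on [D] is then plain equality. *)
Definition retr (x : 'rV[C]_m) := if `[< D x >] then x else x0.

Definition on_dom (g : fct) : fct := g \o retr.

Definition der (g : fct) : fct := fun x => 'D_v g (retr x).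

Lemma retrD x : D (retr x).
Proof. by rewrite /retr; case: asboolP. Qed.

Lemma retr_id x : D x -> retr x = x.
Proof. by rewrite /retr; case: asboolP. Qed.

Lemma retrK x : retr (retr x) = retr x.
Proof. exact/retr_id/retrD. Qed.

Lemma is_derive_on_dom (g : fct) dg x : D x -> is_derive x v g dg ->
  is_derive x v (on_dom g) dg.
Proof.
move=> Dx; apply: near_eq_is_derive; near=> t.
rewrite /on_dom /= retr_id //.
by near: t; apply: open_nbhs_nbhs.
Unshelve. all: by end_near.
Qed.

Lemma is_derive_coord (i : 'I_m) (x : 'rV[C]_m) :
  is_derive x v (fun x : 'rV[C]_m => x 0 i) (v 0 i).
Proof.
have E : (fun h : C => h^-1 *: (((fun x : 'rV[C]_m => x 0 i) \o shift x) (h *: v) - x 0 i)) @ 0^' --> v 0 i.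
  apply: cvg_near_cst; near=> h.
  rewrite /= !mxE addrK /GRing.scale /= mulrA mulVf ?mul1r //.
  by near: h; apply: nbhs_dnbhs_neq.
split; first by apply/cvg_ex; exists (v 0 i).
exact: cvg_lim E.
Unshelve. all: by end_near.
Qed.


Lemma der_on_dom (g dg : fct) : (forall x, D x -> is_derive x v g (dg x)) ->
  der (on_dom g) = on_dom dg.
Proof.
move=> Dg; apply/funext=> x; rewrite /der.
have Dx := retrD x; have [_] := is_derive_on_dom Dx (Dg _ Dx).
exact.
Qed.

Definition derivable_fct (g : fct) : Prop :=
  g = on_dom g /\ forall x, D x -> derivable g x v.

Lemma derivable_on_dom (g dg : fct) : (forall x, D x -> is_derive x v g (dg x)) ->
  derivable_fct (on_dom g).
Proof.
move=> Dg; split; first by apply/funext=> x; rewrite /on_dom /= retrK.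
by move=> x Dx; have [] := is_derive_on_dom Dx (Dg _ Dx).
Qed.

Lemma derivable_fctB g h : derivable_fct g -> derivable_fct h -> derivable_fct (g - h).
Proof.
move=> [Eg dg] [Eh dh]; split.
  by apply/funext=> x; rewrite /on_dom /= {1}Eg {1}Eh.
by move=> x Dx; apply: derivableB; [apply: dg|apply: dh].
Qed.

Lemma derivable_fctM g h : derivable_fct g -> derivable_fct h -> derivable_fct (g * h).
Proof.
move=> [Eg dg] [Eh dh]; split.
  by apply/funext=> x; rewrite /on_dom /= {1}Eg {1}Eh.
by move=> x Dx; apply: derivableM; [apply: dg|apply: dh].
Qed.

Lemma fct_derB g h : derivable_fct g -> derivable_fct h -> der (g - h) = der g - der h.
Proof.
move=> [_ dg] [_ dh]; apply/funext=> x; rewrite /der.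
by rewrite deriveB //; [apply/dg/retrD|apply/dh/retrD].
Qed.

Lemma fct_derD g h : derivable_fct g -> derivable_fct h -> der (g + h) = der g + der h.
Proof.
move=> [_ dg] [_ dh]; apply/funext=> x; rewrite /der.
by rewrite deriveD //; [apply/dg/retrD|apply/dh/retrD].
Qed.

Lemma fct_derM g h : derivable_fct g -> derivable_fct h ->
  der (g * h) = der g * h + g * der h.
Proof.
move=> [Eg dg] [Eh dh]; apply/funext=> x; rewrite /der deriveM; last 2 first.
- exact/dg/retrD.
- exact/dh/retrD.
have gx : g (retr x) = g x by rewrite [in RHS]Eg.
have hx : h (retr x) = h x by rewrite [in RHS]Eh.
rewrite gx hx /GRing.scale /= addrC; congr (_ + _); exact: mulrC.
Qed.

Inductive gen_ring (B : set fct) : set fct :=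
| GenIn g : B g -> gen_ring B g
| GenB g h : gen_ring B g -> gen_ring B h -> gen_ring B (g - h)
| GenM g h : gen_ring B g -> gen_ring B h -> gen_ring B (g * h).

Section GenRing.
Variable B : set fct.
Hypotheses (B1 : B 1) (dB : forall g, B g -> derivable_fct g)
  (derB : forall g, B g -> gen_ring B (der g)).

Lemma gen_ring_subring : subring (gen_ring B).
Proof. by split; [apply: GenIn|apply: GenB|apply: GenM]. Qed.

Lemma gen_ring_derivable g : gen_ring B g -> derivable_fct g.
Proof.
elim=> [h Bh|g1 g2 _ d1 _ d2|g1 g2 _ d1 _ d2].
- exact: dB Bh.
- exact: derivable_fctB d1 d2.
- exact: derivable_fctM d1 d2.
Qed.

Lemma gen_ring_der g : gen_ring B g -> gen_ring B (der g).
Proof.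
have hT := gen_ring_subring.
elim=> [h Bh|g1 g2 T1 d1 T2 d2|g1 g2 T1 d1 T2 d2].
- exact: derB Bh.
- rewrite (fct_derB (gen_ring_derivable T1) (gen_ring_derivable T2)).
  exact: GenB d1 d2.
rewrite (fct_derM (gen_ring_derivable T1) (gen_ring_derivable T2)).
apply/(mem_subP hT)/rpredD; apply/mem_subP; first exact: GenM d1 T2.
exact: GenM T1 d2.
Qed.

End GenRing.

End DirectionalDerivative.

(** Names for the elements of the differential ring generated by a sequence. They
    are countable, hence so is that ring. *)
Inductive ring_term : Type :=
| RGen of nat
| RSub of ring_term & ring_term
| RMul of ring_term & ring_term
| RDer of ring_term.

Section RingTerms.
Variables (U : fieldType) (delta : U -> U) (gens : nat -> U).

Fixpoint ring_term_eval (t : ring_term) : U :=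
  match t with
  | RGen n => gens n
  | RSub t u => ring_term_eval t - ring_term_eval u
  | RMul t u => ring_term_eval t * ring_term_eval u
  | RDer t => delta (ring_term_eval t)
  end.

Fixpoint ring_term_code (t : ring_term) : GenTree.tree nat :=
  match t with
  | RGen n => GenTree.Leaf n
  | RSub t u => GenTree.Node 0 [:: ring_term_code t; ring_term_code u]
  | RMul t u => GenTree.Node 1 [:: ring_term_code t; ring_term_code u]
  | RDer t => GenTree.Node 2 [:: ring_term_code t]
  end.

Fixpoint ring_term_decode (t : GenTree.tree nat) : ring_term :=
  match t with
  | GenTree.Leaf n => RGen n
  | GenTree.Node 0 [:: t; u] => RSub (ring_term_decode t) (ring_term_decode u)
  | GenTree.Node 1 [:: t; u] => RMul (ring_term_decode t) (ring_term_decode u)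
  | GenTree.Node 2 [:: t] => RDer (ring_term_decode t)
  | _ => RGen 0
  end.

Lemma ring_term_codeK : cancel ring_term_code ring_term_decode.
Proof. by elim=> //= [t -> u ->|t -> u ->|t ->]. Qed.

Lemma ring_term_enumerable : enumerable (range ring_term_eval).
Proof.
exists (fun n => if choice.unpickle n is Some t then
  ring_term_eval (ring_term_decode t) else 0) => _ [t _ <-].
by exists (choice.pickle (ring_term_code t)) => //; rewrite choice.pickleK ring_term_codeK.
Qed.

End RingTerms.


Lemma adjoin_dsubfield (U : fieldType) (delta : U -> U) (F : set U) a :
    derivation delta -> dsubfield delta F -> fgen (F `|` [set a]) (delta a) ->
  dsubfield delta (fgen (F `|` [set a])).
Proof.
move=> hd [hF dF] Fa; split; first exact: fgen_subfield.
move=> x; apply: fgen_der => // [|{}x [Fx|->] //]; first exact: fgen_subfield.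
by apply: sub_fgen; left; apply: dF.
Qed.

Lemma constant_tower (U : fieldType) (delta : U -> U) (K : set U) (s : seq U) :
    derivation delta -> dsubfield delta K -> (forall c, c \in s -> delta c = 0) ->
  exists F, [/\ simple_tower delta K F, dsubfield delta F & [set` s] `<=` F].
Proof.
move=> hd dK; elim: s => [|c s IH] s0; first by exists K; split=> //; constructor.
have [|F [tF dF sF]] := IH; first by move=> x xs; apply: s0; rewrite in_cons xs orbT.
have dF' : dsubfield delta (fgen (F `|` [set c])).
  apply: adjoin_dsubfield => //; rewrite s0 ?mem_head //.
  exact: (subfield0 (@fgen_subfield _ _)).
exists (fgen (F `|` [set c])); split=> //; first exact: SimpleTowerS.
move=> x /=; rewrite in_cons => /orP[/eqP->|xs]; apply: sub_fgen; first by right.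
by left; apply: sF.
Qed.

Section TowerStep.
Variables (R : comNzRingType) (D : R -> R) (T J : set R).
Hypotheses (hT : subring T).
Hypotheses (DD : forall x y, T x -> T y -> D (x + y) = D x + D y)
  (DM : forall x y, T x -> T y -> D (x * y) = D x * y + x * D y).
Hypotheses (idJ : diff_ideal D T J) (J0 : J 0)
  (primeJ : forall a b, T a -> T b -> J (a * b) -> J a \/ J b).
Variables (U : fieldType) (delta : U -> U) (hU : DCF0 delta).
Hypotheses (hsat : saturated delta)
  (ncard : forall C : set U, enumerable C -> ~ ([set: U] #<= C)%card).
Variable K : set U.

Lemma rational_subring S psi (F : set U) : place D T J delta S psi ->
  subfield F -> subring [set x | S x /\ F (psi x)].
Proof.
move=> [hS _ _ _ p1 pB pM _ _] hF; have [S1 SB SM] := hS; split=> /=.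
- by rewrite p1; split=> //; apply: subfield1.
- move=> x y [Sx Fx] [Sy Fy]; rewrite pB //.
  by split; [apply: SB|apply: subfieldB].
move=> x y [Sx Fx] [Sy Fy]; rewrite pM //.
by split; [apply: SM|apply: subfieldM].
Qed.

(** The elements of [S] with image in [F] form a subring, so [D y] being a
    polynomial in [y] over it makes [fgen (F `|` [set psi' y])] closed under
    the derivation. *)
Lemma tower_step S psi F y : place D T J delta S psi ->
    simple_tower delta K F -> dsubfield delta F -> T y ->
    adjoin [set x | S x /\ F (psi x)] y (D y) ->
  exists S' psi' F', [/\ place D T J delta S' psi', simple_tower delta K F',
    dsubfield delta F', forall x, S x -> S' x /\ psi' x = psi x
    & F `<=` F' /\ (S' y /\ F' (psi' y))].
Proof.
move=> hpsi tF dF Ty [p Sp Dy]; have [hF _] := dF.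
have hS := place_subring hpsi.
have [psi' [hpsi' Epsi]] := extend_place hT DD DM idJ J0 primeJ hU hsat ncard hpsi Ty
  (fun i => proj1 (Sp i)) Dy.
pose F' := fgen (F `|` [set psi' y]).
have hF' : subfield F' by apply: fgen_subfield.
have FF' : F `<=` F' by apply: subset_fgen1.
have S'y : adjoin S y y := mem_adjoin y hS.
have F'y : F' (psi' y) by apply: sub_fgen; right.
have sub : adjoin [set x | S x /\ F (psi x)] y `<=` [set x | adjoin S y x /\ F' (psi' x)].
  apply: adjoin_min => //; first exact: rational_subring hpsi' hF'.
  move=> x [Sx Fx]; split; first exact: sub_adjoin hS _ Sx.
  by rewrite Epsi //; apply: FF'.
have [S'Dy F'Dy] : adjoin S y (D y) /\ F' (psi' (D y)) by apply: sub; exists p.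
have dF' : dsubfield delta F'.
  apply: adjoin_dsubfield => //; first by case: hU.
  by rewrite -(place_der hpsi').
exists (adjoin S y), psi', F'; split=> //; first exact: SimpleTowerS.
by move=> x Sx; split; [apply: sub_adjoin hS _ Sx|apply: Epsi].
Qed.

End TowerStep.

Lemma meval_subring (R : realType) (m n : nat) (P' : set ('rV[Cplx R]_m -> Cplx R))
    (a : 'I_n -> 'rV[Cplx R]_m -> Cplx R) (P : mpoly n (Cplx R)) :
    subring P' -> (forall mon, P' (fun=> mcoeff mon P)) -> (forall k, P' (a k)) ->
  P' (fun x => meval (fun k => a k x) P).
Proof.
move=> hP Pc Pa; have mP x : P' x <-> x \in mem_sub hP.
  by split=> /(mem_subP hP).
apply: (mpoly_ring_ind (S := [set c | P' (fun=> c)])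
  (P := fun P => P' (fun x => meval (fun k => a k x) P))) Pc => [|||i|p q Hp Hq|p q Hp Hq].
- rewrite (_ : (fun x => _) = 0); first exact/mP/rpred0.
  by apply/funext=> x; rewrite meval0.
- rewrite (_ : (fun x => _) = 1); first exact/mP/rpred1.
  by apply/funext=> x; rewrite meval1.
- move=> c Pc; rewrite (_ : (fun x => _) = (fun=> c)) //.
  by apply/funext=> x; rewrite mevalC.
- rewrite (_ : (fun x => _) = a i) //.
  by apply/funext=> x; rewrite mevalXU.
- rewrite (_ : (fun x => _) = (fun x => meval (fun k => a k x) p) +
    (fun x => meval (fun k => a k x) q)); last by apply/funext=> x; rewrite mevalD.
  by apply/mP/rpredD; apply/mP.
- rewrite (_ : (fun x => _) = (fun x => meval (fun k => a k x) p) *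
    (fun x => meval (fun k => a k x) q)); last by apply/funext=> x; rewrite mevalM.
  by apply/mP/rpredM; apply/mP.
Qed.

Section PfaffianTower.
Variables (R : realType) (U : fieldType) (delta : U -> U).
Variable iota : {rmorphism Cplx R -> U}.
Hypotheses (hU : DCF0 delta) (hsat : saturated delta).
Hypothesis iota_const : forall c, delta (iota c) = 0.
Notation C := (Cplx R).

Let hd : derivation delta.
Proof. by case: hU. Qed.

Variables (m : nat) (D : set 'rV[C]_m) (x0 : 'rV[C]_m) (j : 'I_m) (A : set U).
Variable sigma : U -> 'rV[C]_m -> C.
Hypotheses (oD : open D) (Dx0 : D x0).
Hypothesis rlz : realization delta iota D j A sigma.
Variables (l : nat) (chain : 'I_l -> 'rV[C]_m -> C).
Variable (p : forall i : 'I_l, mpoly (m + i.+1) C).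
Hypothesis chainE : forall i, partial_on D j (chain i)
  (fun x => meval (@pfaffian_args R m l chain i x) (p i)).

Notation fct := ('rV[C]_m -> C).
Let v : 'rV[C]_m := delta_mx 0 j.
Notation res := (on_dom D x0).
Notation Der := (der D x0 v).

Let sg (a : U) : fct := res (sigma a).
Let co (i : 'I_m) : fct := res (fun x => x 0 i).
Let ch (i : 'I_l) : fct := res (chain i).
Let arg (i : 'I_l) (k : 'I_(m + i.+1)) : fct := res (fun x => @pfaffian_args R m l chain i x k).

Let gens : set fct := [set g |
  [\/ exists2 a, A a & g = sg a, exists i, g = co i | exists i, g = ch i]].
Let T : set fct := gen_ring gens.

Lemma sg_const c : sg (iota c) = (fun=> c).
Proof. by apply/funext=> x; apply: (rlz_sigma_const rlz); apply: retrD. Qed.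

Lemma arg_in (P : set fct) (i : 'I_l) (k : 'I_(m + i.+1)) :
  (forall a, P (co a)) -> (forall b : 'I_l, (b <= i)%N -> P (ch b)) -> P (arg k).
Proof.
move=> Pco Pch.
have [[a ->]|[b bi ->]] : (exists a, arg k = co a) \/
    (exists2 b : 'I_l, (b <= i)%N & arg k = ch b).
- rewrite /arg /pfaffian_args; case: fintype.split => [a|b]; first by left; exists a.
  by right; exists (widen_ord (ltn_ord i) b) => //=; rewrite -ltnS.
- exact: Pco.
exact: Pch.
Qed.

Lemma Der_sg a : A a -> Der (sg a) = sg (delta a).
Proof. by move=> Aa; apply: der_on_dom (rlz_sigma_der rlz Aa). Qed.

Lemma Der_co i : Der (co i) = sg (iota (v 0 i)).
Proof.
rewrite sg_const; apply: (der_on_dom oD Dx0 (dg := fun=> v 0 i)) => x _.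
exact: is_derive_coord.
Qed.

Lemma Der_ch i : Der (ch i) = (fun x => meval (fun k => @arg i k x) (p i)).
Proof. by rewrite (der_on_dom oD Dx0 (chainE i)). Qed.

Lemma gens1 : gens 1.
Proof.
by apply: Or31; exists (iota 1); [apply: (rlz_const rlz)|rewrite sg_const].
Qed.

Lemma gens_derivable g : gens g -> derivable_fct D x0 v g.
Proof.
case=> [[a Aa ->]|[i ->]|[i ->]].
- exact: (derivable_on_dom oD Dx0 (rlz_sigma_der rlz Aa)).
- by apply: (derivable_on_dom oD Dx0 (dg := fun=> v 0 i)) => x _; apply: is_derive_coord.
- exact: (derivable_on_dom oD Dx0 (chainE i)).
Qed.

Lemma gens_der g : gens g -> gen_ring gens (Der g).
Proof.
have Tsg a : A a -> T (sg a) by move=> Aa; apply/GenIn/Or31; exists a.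
case=> [[a Aa ->]|[i ->]|[i ->]].
- by rewrite Der_sg //; apply/Tsg/(rlz_der rlz).
- by rewrite Der_co; apply/Tsg/(rlz_const rlz).
rewrite Der_ch; apply: meval_subring.
- exact: gen_ring_subring gens1.
- by move=> mon; rewrite -sg_const; apply/Tsg/(rlz_const rlz).
move=> k; apply: (arg_in (P := T)) => [a|b _]; apply: GenIn.
  by apply: Or32; exists a.
by apply: Or33; exists b.
Qed.

Lemma sg_add a b : A a -> A b -> sg (a + b) = sg a + sg b.
Proof.
by move=> Aa Ab; apply/funext=> x; apply: (rlz_sigma_add rlz) => //; apply: retrD.
Qed.

Lemma sg_mul a b : A a -> A b -> sg (a * b) = sg a * sg b.
Proof.
by move=> Aa Ab; apply/funext=> x; apply: (rlz_sigma_mul rlz) => //; apply: retrD.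
Qed.

Lemma A_opp a : A a -> A (- a).
Proof.
move=> Aa; rewrite -mulN1r -(rmorph1 iota) -rmorphN.
by apply: (rlz_mul rlz) => //; apply: (rlz_const rlz).
Qed.

Lemma A_sub a b : A a -> A b -> A (a - b).
Proof. by move=> Aa Ab; apply: (rlz_add rlz) => //; apply: A_opp. Qed.

Lemma sg_sub a b : A a -> A b -> sg (a - b) = sg a - sg b.
Proof.
move=> Aa Ab; rewrite sg_add //; last exact: A_opp.
congr (_ + _); rewrite -mulN1r -(rmorph1 iota) -rmorphN sg_mul //; last exact: (rlz_const rlz).
rewrite sg_const; apply/funext=> x; exact: mulN1r.
Qed.

Lemma sg_inj a b : A a -> A b -> sg a = sg b -> a = b.
Proof.
move=> Aa Ab ab; apply/eqP; rewrite -subr_eq0; apply/eqP.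
apply: (rlz_sigma_inj rlz); first exact: A_sub.
have E : sg (a - b) = 0 by rewrite sg_sub // ab subrr.
move=> x Dx; have := congr1 (fun g : fct => g x) E.
by rewrite /sg /on_dom /= retr_id.
Qed.

Lemma sg0 : sg 0 = 0.
Proof. by rewrite -(rmorph0 iota) sg_const. Qed.

Let M : set fct := [set g | exists a, [/\ A a, a != 0 & g = sg a]].

(** The functions may include zero divisors. Modulo [J] they form a domain, into
    which [A] still embeds as [J] avoids its nonzero elements. *)
Lemma prime_ideal : exists J, [/\ diff_ideal Der T J, J 0, J `&` M = set0 &
  forall a b, T a -> T b -> J (a * b) -> J a \/ J b].
Proof.
have [T1 TB TM] := gen_ring_subring gens1.
have Td g : T g -> derivable_fct D x0 v g by apply: gen_ring_derivable; apply: gens_derivable.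
apply: prime_diff_ideal => //.
- by move=> g; apply: (gen_ring_der Dx0 gens1 gens_derivable gens_der).
- by move=> g h Tg Th; apply: (fct_derD Dx0 (Td g Tg) (Td h Th)).
- by move=> g h Tg Th; apply: (fct_derM Dx0 (Td g Tg) (Td h Th)).
- by move=> _ [a [Aa _ ->]]; apply/GenIn/Or31; exists a.
- exists (iota 1); rewrite rmorph1 oner_eq0 -(rmorph1 iota) sg_const.
  by split=> //; apply: (rlz_const rlz).
- move=> _ _ [a [Aa a0 ->]] [b [Ab b0 ->]]; exists (a * b).
  by rewrite mulf_neq0 // sg_mul //; split=> //; apply: (rlz_mul rlz).
- move=> n; exists (iota n.+1%:R); rewrite fmorph_eq0 pnatr_eq0 sg_const.
  split=> //; first exact: (rlz_const rlz).
  apply/funext=> x; elim: n.+1 => [|k IH] //.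
  by rewrite -!natr1 -IH.
move=> [a [Aa a0 sa0]]; move/eqP: a0; apply; apply: sg_inj => //.
  by rewrite -(rmorph0 iota); apply: (rlz_const rlz).
by rewrite -sa0 sg0.
Qed.


Variables (f : U) (Af : A f) (q : mpoly l C).
Hypothesis fE : forall x, D x -> sigma f x = meval (fun i => chain i x) q.
Variables (K : set U) (dK : dsubfield delta K).

Let coefs n (P : mpoly n C) : seq C := [seq mcoeff mon P | mon <- msupp P].
(* [1] makes the generated ring unital, and [0] stands for the coefficients off
   the support. *)
Let cs : seq C := [:: 0, 1 & coefs q ++ flatten [seq coefs (p i) | i <- enum 'I_l]].
Let gen (n : nat) : U := if n is k.+1 then iota cs`_k else f.
Let B0 : set U := range (ring_term_eval delta gen).
Let S0 : set fct := sg @` B0.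

Let mem_coefs n (P : mpoly n C) mon : mcoeff mon P \in 0 :: coefs P.
Proof.
rewrite in_cons; have [->|P0] := eqVneq (mcoeff mon P) 0; first by [].
by apply/mapP; exists mon; rewrite ?mcoeff_msupp.
Qed.

Lemma coef_q mon : mcoeff mon q \in cs.
Proof.
have := mem_coefs q mon; rewrite !in_cons mem_cat => /orP[->//|->].
by rewrite !orbT.
Qed.

Lemma coef_p i mon : mcoeff mon (p i) \in cs.
Proof.
have := mem_coefs (p i) mon; rewrite !in_cons mem_cat => /orP[->//|cp].
rewrite (_ : _ \in flatten _) ?orbT //; apply/flatten_mapP; exists i => //.
by rewrite mem_enum.
Qed.

Lemma B0_const c : c \in cs -> B0 (iota c).
Proof.
move=> /(nthP 0)[k kcs <-]; exists (RGen k.+1) => //.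
Qed.

Lemma B0_f : B0 f.
Proof. by exists (RGen 0). Qed.

Lemma B0_A : B0 `<=` A.
Proof.
move=> _ [t _ <-]; elim: t => [[|k]|t At u Au|t At u Au|t At] //=.
- exact: (rlz_const rlz).
- exact: A_sub.
- exact: (rlz_mul rlz).
- exact: (rlz_der rlz).
Qed.

Lemma B0_subring : subring B0.
Proof.
split=> [|_ _ [t _ <-] [u _ <-]|_ _ [t _ <-] [u _ <-]].
- by rewrite -(rmorph1 iota); apply: B0_const; rewrite !in_cons eqxx orbT.
- by exists (RSub t u).
- by exists (RMul t u).
Qed.

Lemma initial_place J : J 0 -> J `&` M = set0 ->
  exists psi, place Der T J delta S0 psi /\ forall b, B0 b -> psi (sg b) = b.
Proof.
move=> J0 dJ; have [B1 BB BM] := B0_subring.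
have /choice[psi Dpsi] : forall g : fct, exists u, forall b, B0 b -> g = sg b -> u = b.
  move=> g; have [[b [Bb ->]]|none] := pselect (exists b, B0 b /\ g = sg b).
    by exists b => c Bc; apply: sg_inj; apply: B0_A.
  by exists 0 => b Bb gb; case: none; exists b.
have psiE b : B0 b -> psi (sg b) = b by move=> Bb; apply: Dpsi.
have B_der b : B0 b -> B0 (delta b) by move=> [t _ <-]; exists (RDer t).
exists psi; split=> //; split.
- split.
  + by exists 1 => //; rewrite -(rmorph1 iota) sg_const.
  + move=> _ _ [a Ba <-] [b Bb <-]; exists (a - b); first exact: BB.
    by apply: sg_sub; apply: B0_A.
  + move=> _ _ [a Ba <-] [b Bb <-]; exists (a * b); first exact: BM.
    by apply: sg_mul; apply: B0_A.
- by move=> _ [a Ba <-]; apply/GenIn/Or31; exists a => //; apply: B0_A.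
- move=> _ [a Ba <-]; exists (delta a); first exact: B_der.
  by rewrite Der_sg //; apply: B0_A.
- have [e Be] := ring_term_enumerable delta gen.
  exists (sg \o e) => _ [a Ba <-]; have [k _ <-] := Be a Ba; by exists k.
- have -> : (1 : fct) = sg 1 by rewrite -(rmorph1 iota) sg_const.
  exact: psiE.
- move=> _ _ [a Ba <-] [b Bb <-]; rewrite -sg_sub ?psiE //; try exact: B0_A.
  exact: BB.
- move=> _ _ [a Ba <-] [b Bb <-]; rewrite -sg_mul ?psiE //; try exact: B0_A.
  exact: BM.
- move=> _ [a Ba <-]; rewrite Der_sg ?psiE //; last exact: B0_A.
  exact: B_der.
move=> _ [a Ba <-]; rewrite psiE //; split=> [->|Ja]; first by rewrite sg0.
apply/eqP; apply: contrapT => /negP a0.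
suff : (J `&` M) (sg a) by rewrite dJ.
by split=> //; exists a; split=> //; apply: B0_A.
Qed.

(** Over the countable ring [S0] the coordinates and the functions of the chain
    are adjoined one at a time; their values in the model generate a simple
    tower over [K], which contains [f] because [f] is a polynomial in them. *)
Lemma pfaffian_tower : exists F, simple_tower delta K F /\ F f.
Proof.
have [J [idJ J0 dJ primeJ]] := prime_ideal.
have [psi0 [hpsi0 Epsi0]] := initial_place J0 dJ.
have hT := gen_ring_subring gens1.
have Td g : T g -> derivable_fct D x0 v g by apply: gen_ring_derivable; apply: gens_derivable.
have DD g h : T g -> T h -> Der (g + h) = Der g + Der h.
  by move=> Tg Th; apply: (fct_derD Dx0 (Td g Tg) (Td h Th)).
have DM g h : T g -> T h -> Der (g * h) = Der g * h + g * Der h.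
  by move=> Tg Th; apply: (fct_derM Dx0 (Td g Tg) (Td h Th)).
have ncard := not_card_le_enumerable iota.
pose Inv (Y : set fct) := exists S psi F, [/\ place Der T J delta S psi,
  simple_tower delta K F, dsubfield delta F,
  S (sg f) /\ psi (sg f) = f
  & (forall c, c \in cs -> S (fun=> c) /\ F (psi (fun=> c))) /\
    forall y, Y y -> S y /\ F (psi y)].
(* [f] is kept in [S], but not among the elements whose image is known to lie
   in [F]: that is the conclusion. *)
pose rational (P Y : set fct) :=
  [/\ subring P, forall c, c \in cs -> P (fun=> c) & Y `<=` P].
have stepInv Y y : Inv Y -> T y ->
    (forall P, rational P Y -> adjoin P y (Der y)) -> Inv (Y `|` [set y]).
  move=> [S [psi [F [hpsi tF dF [Sf Ef] [Fc FY]]]]] Ty Dy.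
  have [|S' [psi' [F' [hpsi' tF' dF' SS' [FF' [S'y F'y]]]]]] :=
    tower_step hT DD DM idJ J0 primeJ hU hsat ncard hpsi tF dF Ty.
    apply: Dy; split; first exact: rational_subring hpsi (proj1 dF).
      by move=> c /Fc.
    by move=> z /FY.
  have up z : S z /\ F (psi z) -> S' z /\ F' (psi' z).
    by move=> [/SS'[S'z ->] Fz]; split=> //; apply: FF'.
  exists S', psi', F'; split=> //.
    by have [? ->] := SS' _ Sf.
  by split=> [c /Fc/up|z [/FY/up|->]].
have Inv0 : Inv set0.
  have [|F [tF dF sF]] := @constant_tower U delta K (map iota cs) hd dK.
    by move=> _ /mapP[c _ ->]; apply: iota_const.
  exists S0, psi0, F; split=> //.
    by split; [exists f => //; apply: B0_f|apply: Epsi0; apply: B0_f].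
  split=> // c ccs; rewrite -sg_const; split; first by exists (iota c) => //; apply: B0_const.
  by rewrite Epsi0; [apply: sF; apply: map_f|apply: B0_const].
have Inv_co k : (k <= m)%N -> Inv [set g | exists2 i : 'I_m, (i < k)%N & g = co i].
  elim: k => [_|k IH km].
    by rewrite (_ : [set g | _] = set0) //; apply/seteqP; split=> g // [].
  have -> : [set g | exists2 i : 'I_m, (i < k.+1)%N & g = co i] =
      [set g | exists2 i : 'I_m, (i < k)%N & g = co i] `|` [set co (Ordinal km)].
    apply/seteqP; split=> g /=.
      case=> i; rewrite ltnS leq_eqVlt => /orP[/eqP ik ->|ik ->]; last by left; exists i.
      by right; congr (co _); apply: val_inj.
    by move=> [[i ik ->]|->]; [exists i => //; apply: ltnW|exists (Ordinal km)].
  apply: stepInv; first exact: IH (ltnW km).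
    by apply/GenIn/Or32; exists (Ordinal km).
  move=> P [hP Pc _]; rewrite Der_co sg_const; apply: sub_adjoin => //; apply: Pc.
  by rewrite /v mxE !in_cons; case: (_ && _); rewrite eqxx ?orbT.
have Inv_ch k : (k <= l)%N -> Inv ([set g | exists i, g = co i] `|`
    [set g | exists2 i : 'I_l, (i < k)%N & g = ch i]).
  elim: k => [_|k IH kl].
    rewrite (_ : [set g | exists2 _, _ & _] = set0) ?setU0; last first.
      by apply/seteqP; split=> g // [].
    rewrite (_ : [set g | _] = [set g | exists2 i : 'I_m, (i < m)%N & g = co i]).
      exact: Inv_co.
    by apply/seteqP; split=> g /= => [[i ->]|[i _ ->]]; exists i.
  have -> : [set g | exists2 i : 'I_l, (i < k.+1)%N & g = ch i] =
      [set g | exists2 i : 'I_l, (i < k)%N & g = ch i] `|` [set ch (Ordinal kl)].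
    apply/seteqP; split=> g /=.
      case=> i; rewrite ltnS leq_eqVlt => /orP[/eqP ik ->|ik ->]; last by left; exists i.
      by right; congr (ch _); apply: val_inj.
    by move=> [[i ik ->]|->]; [exists i => //; apply: ltnW|exists (Ordinal kl)].
  rewrite setUA; apply: stepInv; first exact: IH (ltnW kl).
    by apply/GenIn/Or33; exists (Ordinal kl).
  move=> P [hP Pc PY]; rewrite Der_ch; set y := ch _.
  have Py : subring (adjoin P y) := adjoin_subring y hP.
  apply: meval_subring => // [mon|t].
    by apply: sub_adjoin => //; apply: Pc; apply: coef_p.
  apply: (arg_in (P := adjoin P y)) => [a|b].
    by apply: sub_adjoin => //; apply: PY; left; exists a.
  rewrite leq_eqVlt => /orP[/eqP bk|bk].
    rewrite (_ : ch b = y); first exact: mem_adjoin.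
    by congr (ch _); apply: val_inj.
  by apply: sub_adjoin => //; apply: PY; right; exists b.
have [S [psi [F [hpsi tF dF [Sf Ef] [Fc FY]]]]] := Inv_ch l (leqnn l).
exists F; split=> //; rewrite -Ef.
have hP := rational_subring hpsi (proj1 dF).
suff [] : S (sg f) /\ F (psi (sg f)) by [].
have -> : sg f = (fun x => meval (fun i => ch i x) q).
  by apply/funext=> x; apply: fE; apply: retrD.
apply: (meval_subring hP) => [mon|i]; first exact: Fc (coef_q mon).
by apply: FY; right; exists i.
Qed.

End PfaffianTower.

(** * Towers that reach a solution *)

Section Towers.
Variables (U : fieldType) (delta : U -> U) (hU : DCF0 delta).
Variables (K X : set U) (n : nat).
Hypotheses (dK : dsubfield delta K) (eqX : diff_equation delta K X).
Hypotheses (smX : strongly_minimal delta X) (ordX : has_order delta K X n).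
Variable f : U.
Hypotheses (Xf : X f) (nf : ~ algebraic_over K f).

Lemma reducible_degree d : reducible delta d K f -> (n <= d)%N.
Proof.
move=> [m [F [F0 Fmf genF stepF]]].
apply: (tower_degree hU dK eqX smX ordX F0 _ stepF Fmf Xf nf) => i im.
by have [S _ ->] := genF i im; apply: dgen_dsubfield.
Qed.

Lemma tower_ext_degree step L : tower_ext delta step K L -> L f -> (n <= 1)%N.
Proof.
move=> [_ [m [F [a [F0 Fm dF stepF]]]]] Lf.
rewrite -Fm in Lf.
have genF i : (i < m)%N -> F i.+1 = fgen (F i `|` [set a i]) by case/stepF.
exact: (simple_tower_degree hU dK eqX smX ordX F0 dF genF Lf Xf nf).
Qed.

Lemma pfaffian_degree (R : realType) (iota : {rmorphism Cplx R -> U}) :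
    saturated delta -> (forall c, delta (iota c) = 0) ->
  pfaffian delta iota K f -> (n <= 1)%N.
Proof.
move=> hsat iota_const [m [D [j [A [sigma [[[x0 Dx0] oD _] rlz _ Af]]]]]].
move=> [l [chain [q [[_ [p chainE]] fE]]]].
have [F [tF Ff]] := pfaffian_tower hU hsat iota_const oD Dx0 rlz
  (fun i => chainE i j) Af fE dK.
have [k [E [a [E0 Ek dE stepE]]]] := simple_tower_chain dK tF.
rewrite -Ek in Ff.
exact: (simple_tower_degree hU dK eqX smX ordX E0 dE stepE Ff Xf nf).
Qed.

End Towers.

Theorem theorem4p5 (R : realType) (U : fieldType) (delta : U -> U)
    (iota : {rmorphism Cplx R -> U})
    (hU : DCF0 delta)
    (hsat : saturated delta)
    (hC : forall x : U, delta x = 0%R <-> exists c : Cplx R, x = iota c)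
    (K : set U) (hK : fin_gen_dfield delta K)
    (X : set U) (n : nat)
    (hX : diff_equation delta K X)
    (hsm : strongly_minimal delta X)
    (hn : has_order delta K X n)
    (f : U) (hf : X f) (hnonalg : ~ algebraic_over K f) :
  (forall d : nat, (d < n)%N -> ~ reducible delta d K f) /\
  ((1 < n)%N ->
     [/\ ~ pfaffian delta iota K f,
         ~ liouvillian delta K f
       & ~ elementary delta K f]).
Proof.
have dK : dsubfield delta K by case: hK => S _ ->; apply: dgen_dsubfield.
have iota_const c : delta (iota c) = 0 by apply/hC; exists c.
split=> [d dn red|n1].
  have := reducible_degree hU dK hX hsm hn hf hnonalg red.
  by rewrite leqNgt dn.
have tower step L := @tower_ext_degree U delta hU K X n dK hX hsm hn f hf hnonalg step L.
rewrite ltnNge in n1; split.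
- move=> pf; move/negP: n1; apply.
  exact: (pfaffian_degree hU dK hX hsm hn hf hnonalg hsat iota_const pf).
- by move=> [L tL Lf]; move/negP: n1; apply; apply: (tower _ _ tL Lf).
by move=> [L tL Lf]; move/negP: n1; apply; apply: (tower _ _ tL Lf).
Qed.
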